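(* Let $m\ge2$ be an integer. The sequence of $m$-ary increasing trees $(T_n)_{n=1}^\infty=(T_n^{-1,m})_{n=1}^\infty$, considered as $m$-ary trees, has the same distribution as the sequence of random split trees $(T_n^{\mathcal P})_{n=1}^\infty$ with $b=m$ and split vector $$\mathcal P=(P_i)_{i=1}^m\sim\mathrm{Dir}\Bigl(\frac1{m-1},\dots,\frac1{m-1}\Bigr)$$ (with $m$ parameters).
   Context: **$m$-ary trees.** An $m$-ary tree is a rooted tree where each node has at most $m$ children, and the children of a node are labelled by distinct numbers in $\{1,\dots,m\}$ (not all labels need be present). Equivalently, it is a subtree containing the root of the infinite $m$-ary tree $\mathcal T_m$, in which each node has exactly $m$ children, labelled $1,\dots,m$. The external nodes of an $m$-ary tree $T$ are the nodes of $\mathcal T_m$ not in $T$ whose parent is in $T$. **$m$-ary increasing trees.** $T_n^{-1,m}$ is the linear preferential attachment tree with weights $w_k=m-k$: $T_1$ is a single root, and $T_{n+1}$ is obtained from $T_n$ by adding a new node as a child of an existing node, chosen to be $v$ with probability proportional to $w_{d(v)}=m-d(v)$, where $d(v)$ is the current number of children of $v$. It is regarded as an $m$-ary tree by labelling the children of each node by $1,\dots,m$ in uniformly random order; equivalently, $T_1$ is the root of $\mathcal T_m$, and $T_{n+1}$ is obtained from $T_n$ by converting a uniformly chosen random external node of $T_n$ to a node. **Random split tree** with $b=m$. Let $\mathcal P=(P_i)_{i=1}^m$ be a random vector with $P_i\ge0$ and $\sum_i P_i=1$ (the split vector). Give each node $v$ of $\mathcal T_m$ an independent copy $\mathcal P^{(v)}=(P^{(v)}_i)_{i=1}^m$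 of $\mathcal P$, chosen once and kept fixed. Each node holds at most one ball and is full if it holds one; initially all nodes are empty. Balls arrive one by one at the root and move instantaneously: (i) a ball arriving at an empty node stays there, making it full; (ii) a ball arriving at a full node $v$ continues to a child of $v$, child $i$ being chosen with probability $P_i^{(v)}$; given all vectors $\mathcal P^{(v)}$, all these choices are independent. $T_n^{\mathcal P}$ is the subtree of $\mathcal T_m$ consisting of the nodes that contain the first $n$ balls (with the labels of $\mathcal T_m$ kept); all $T_n^{\mathcal P}$, $n\ge1$, are constructed from the same stream of balls. **Dirichlet distribution.** $\mathrm{Dir}(\alpha_1,\dots,\alpha_m)$ is the distribution of a random vector $(X_1,\dots,X_m)$ with $X_i\ge0$, $\sum_{i=1}^m X_i=1$ and density $c\,x_1^{\alpha_1-1}\cdots x_m^{\alpha_m-1}\,dx_1\cdots dx_{m-1}$, where $c=\Gamma(\alpha_1+\dots+\alpha_m)/\prod_{i=1}^m\Gamma(\alpha_i)$. *)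

(* Defs.v *)
From HB Require Import structures.
From mathcomp Require Import all_boot all_order all_algebra all_fingroup.
From mathcomp Require Import finmap.
From mathcomp Require Import all_classical all_reals all_analysis.

Set Implicit Arguments.
Unset Strict Implicit.
Unset Printing Implicit Defensive.

Import Order.TTheory GRing.Theory Num.Theory.
Import numFieldNormedType.Exports.

Local Open Scope classical_set_scope.
Local Open Scope ring_scope.

(* The nodes of the infinite m-ary tree are the words over 'I_m: the root is
   [::] and the child of v with label i is rcons v i (the labels are 0, ...,
   m-1 instead of 1, ..., m).  A finite m-ary tree is its set of nodes. *)
Definition node (m : nat) : Type := seq 'I_m.
Definition tree (m : nat) : Type := {fset seq 'I_m}.

(* The product of the discrete sigma-algebras on the space of sequences. *)
Definition cylinder_sigma (T : Type) : set (set (nat -> T)) :=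
  <<s [set A | exists n (B : set T), A = [set x | B (x n)]] >>.

Definition same_law (R : realType) (T : Type)
    d1 (O1 : measurableType d1) (P1 : probability O1 R) (X : O1 -> nat -> T)
    d2 (O2 : measurableType d2) (P2 : probability O2 R) (Y : O2 -> nat -> T) :
    Prop :=
  forall A, cylinder_sigma A -> P1 (X @^-1` A) = P2 (Y @^-1` A).

Definition discrete_rv d (O : measurableType d) (T : Type) (f : O -> T) : Prop :=
  forall B : set T, measurable (f @^-1` B).

Section preferential_attachment.

(* Nodes are numbered 0, 1, 2, ... by order of arrival, 0 being the root, and
   h k is the parent of node k.+1.  outdegree h n v is the number of children of
   v in the tree made of the nodes 0, ..., n. *)
Definition outdegree (h : nat -> nat) (n v : nat) : nat :=
  count (fun k => h k == v) (iota 0 n).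

Context {R : realType} d {O : measurableType d}.

Definition past (par : nat -> O -> nat) (h : nat -> nat) (n : nat) : set O :=
  [set x | forall k, (k < n)%N -> par k x = h k].

(* Given the tree with nodes 0, ..., n, node n.+1 becomes a child of v with
   conditional probability w_(d v) / \sum_u w_(d u); the identity is multiplied
   by the probability of the conditioning event, so that it also makes sense
   when this event is negligible. *)
Definition preferential_attachment (P : probability O R) (w : nat -> R)
    (par : nat -> O -> nat) : Prop :=
  (forall n, discrete_rv (par n)) /\
  forall (n : nat) (h : nat -> nat) (v : 'I_n.+1),
    P (past par h n `&` [set x | par n x = v]) =
    (P (past par h n) *
     (w (outdegree h n v) / \sum_(u < n.+1) w (outdegree h n u))%:E)%E.

(* The permutations are i.i.d. uniform and independent of the process par. *)
Definition uniform_labelling (m : nat) (P : probability O R)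
    (par : nat -> O -> nat) (s : nat -> O -> {perm 'I_m}) : Prop :=
  (forall v, discrete_rv (s v)) /\
  forall (n l : nat) (h : nat -> nat) (t : nat -> {perm 'I_m}),
    P (past par h n `&` [set x | forall v, (v < l)%N -> s v x = t v]) =
    (P (past par h n) * ((m`!%:R)^-1 ^+ l)%:E)%E.

End preferential_attachment.

(* The positions of the nodes 0, ..., n in the infinite m-ary tree, when the
   j-th child of v, by order of arrival and counting from 0, gets the label
   s v j.  A node with more than m children, which has probability 0 for the
   weights m - k, makes insub fail; the position is then set to [::]. *)
Fixpoint positions (m : nat) (h : nat -> nat) (s : nat -> {perm 'I_m})
    (n : nat) : seq (node m) :=
  if n is k.+1 then
    let a := positions h s k in
    let p := h k in
    let label : option 'I_m := omap (s p) (insub (outdegree h k p)) in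
    rcons a (if label is Some i then rcons (nth [::] a p) i else [::])
  else [:: [::]].

(* The tree with n nodes, for n > 0. *)
Definition labelled_tree (m : nat) (h : nat -> nat) (s : nat -> {perm 'I_m})
    (n : nat) : tree m :=
  [fset v in positions h s n.-1]%fset.

Section dirichlet.
Context {R : realType}.

Definition Gamma (a : R) : R :=
  \int[lebesgue_measure]_(x in `[0, +oo[) (x `^ (a - 1) * expR (- x)).

(* The integral of f >= 0 with respect to the n-dimensional Lebesgue measure,
   as an iterated integral. *)
Fixpoint lebesgue_iint (n : nat) : (n.-tuple R -> \bar R) -> \bar R :=
  if n is k.+1 return (n.-tuple R -> \bar R) -> \bar R then
    fun f => (\int[lebesgue_measure]_x
                lebesgue_iint (fun t : k.-tuple R => f (cons_tuple x t)))%E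
  else fun f => f [tuple].

Definition simplex (m : nat) : set (m.-tuple R) :=
  [set x | (forall i, 0 <= tnth x i) /\ \sum_(i < m) tnth x i = 1].

(* (x_1, ..., x_(m-1), 1 - x_1 - ... - x_(m-1)): the last coordinate is the
   default value of nth. *)
Definition complete_tuple (m : nat) (t : m.-1.-tuple R) : m.-tuple R :=
  [tuple nth (1 - \sum_(i < m.-1) tnth t i) t i | i < m].

Definition dirichlet_pdf (m : nat) (a : 'I_m -> R) (x : m.-tuple R) : R :=
  Gamma (\sum_(i < m) a i) / (\prod_(i < m) Gamma (a i)) *
  \prod_(i < m) (tnth x i) `^ (a i - 1).

Definition dirichlet (m : nat) (a : 'I_m -> R) (B : set (m.-tuple R)) : \bar R :=
  lebesgue_iint (fun t : m.-1.-tuple R =>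
    (\1_(B `&` @simplex m) (complete_tuple t) *
     dirichlet_pdf a (complete_tuple t))%:E).

End dirichlet.

(* c v is the child of the full node v chosen by the ball.  The ball visits
   nodes of increasing depth, so the bound k on the number of moves is not a
   restriction when full is a tree with k nodes. *)
Fixpoint ball_position (m : nat) (c : node m -> 'I_m) (full : tree m)
    (k : nat) (v : node m) : node m :=
  if k is l.+1 then
    if v \in full then ball_position c full l (rcons v (c v)) else v
  else v.

(* The nodes holding the balls 0, ..., n-1, where C k v is the choice of ball k
   at node v. *)
Fixpoint split_tree (m : nat) (C : nat -> node m -> 'I_m) (n : nat) : tree m :=
  if n is k.+1 then
    let T := split_tree C k in
    (ball_position (C k) T k [::] |` T)%fset
  else fset0.

Section split_model.
Context {R : realType} d {O : measurableType d} (P : probability O R).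

Definition mutually_independent (I : choiceType) d' (T : measurableType d')
    (X : I -> {RV P >-> T}) : Prop :=
  forall (J : {fset I}) (B : I -> set T), (forall i, measurable (B i)) ->
    P (\bigcap_(i in [set` J]) (X i @^-1` B i)) =
    (\prod_(i <- J) P (X i @^-1` B i))%E.

Definition generated_sigma (I : Type) d' (T : measurableType d')
    (X : I -> O -> T) : set (set O) :=
  <<s \bigcup_i preimage_set_system setT (X i) measurable >>.

(* The split vectors V v are independent with law D.  Conditionally on all of
   them, the choices C k v of the balls k at the nodes v are independent and
   C k v has law V v: for all distinct (k_1, v_1), ..., (k_r, v_r), the
   conditional probability of C k_j v_j = c_j for j = 1, ..., r given the
   sigma-algebra generated by the vectors is the product of the c_j-th
   coordinates of the vectors V v_j. *)
Definition split_model (m : nat) (D : set (m.-tuple R) -> \bar R)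
    (V : node m -> {RV P >-> m.-tuple R}) (C : nat -> node m -> O -> 'I_m) :
    Prop :=
  [/\ forall v B, measurable B -> distribution P (V v) B = D B,
      mutually_independent V,
      forall k v, discrete_rv (C k v) &
      forall (A : set O), generated_sigma V A ->
      forall (J : {fset nat * node m}) (c : nat * node m -> 'I_m),
        P (A `&` [set x | forall q, q \in J -> C q.1 q.2 x = c q]) =
        (\int[P]_(x in A) (\prod_(q <- J) tnth (V q.2 x) (c q))%:E)%E].

End split_model.

(* Main.v *)
(* A history is the list v_0, ..., v_n of the nodes in order of insertion, each
   one external to the tree made of the previous ones.  A tree with j nodes has
   1 + (m - 1) j external nodes, so there are N = \prod_j (1 + (m - 1) j)
   histories, and it suffices that both processes follow every history with
   probability at least 1 / N: the probabilities then equal 1 / N and nothing is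
   left for other sequences of trees, so all the finite-dimensional laws agree.

   Preferential attachment: the sequence of parents has probability
   \prod_k (m - d_k) / (1 + (m - 1) k), and among the labellings compatible with
   the first k insertions a proportion 1 / (m - d_k) is compatible with the next
   one.

   Split tree: following a history is a prescription of the choices made by the
   balls at the proper prefixes of their final nodes.  Conditioning on the split
   vectors and using their independence, its probability is the product over the
   nodes u of the moment E \prod_i P_i^(N_ui), N_ui being the number of balls
   that enter the subtree of the i-th child of u.  A Dirichlet moment is a
   quotient of rising factorials, and since the sum of the parameters exceeds
   one parameter a by exactly 1, inserting a new node multiplies the product by a
   telescoping quotient along its path, a / (a + n + 1). *)

From HB Require Import structures.
Require Import Defs.
From mathcomp Require Import all_boot all_order all_algebra all_fingroup.
From mathcomp Require Import finmap.
From mathcomp Require Import all_classical all_reals all_analysis.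
From mathcomp Require Import measurable_realfun zify ring lra.

Set Implicit Arguments.
Unset Strict Implicit.
Unset Printing Implicit Defensive.

Import Order.TTheory GRing.Theory Num.Theory.
Import numFieldNormedType.Exports.

Local Open Scope classical_set_scope.
Local Open Scope ring_scope.

(** * Beta integrals *)

Section beta_integrals.
Context {R : realType}.
Local Notation mu := (@lebesgue_measure R).
Implicit Types (p q s x : R).

Lemma lebesgue_measure_scale s (A : set R) : 0 < s -> measurable A ->
  mu A = (s%:E * pushforward mu ( *%R s : measurableTypeR R -> measurableTypeR R) A)%E.
Proof.
move=> s0 mA.
have mphi : measurable_fun setT ( *%R s : measurableTypeR R -> measurableTypeR R).
  exact: measurable_funM.
have s0' : 0 <= s by exact: ltW.
pose f : {mfun measurableTypeR R >-> measurableTypeR R} :=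
  HB.pack ( *%R s : measurableTypeR R -> measurableTypeR R) (isMeasurableFun.Build _ _ _ _ _ mphi).
apply: (@lebesgue_measure_unique R (mscale (NngNum s0') (pushforward mu f))) => //.
move=> _ [[a b]] _ <- /=.
rewrite /mscale/= /pushforward.
have -> : ( *%R s : R -> R) @^-1` `]a, b] = `]a / s, b / s]%classic.
  apply/seteqP; split => x /=; rewrite !in_itv/= ltr_pdivrMr// ler_pdivlMr// mulrC//.
rewrite !lebesgue_measure_itv/= !lte_fin ltr_pdivrMr// divfK ?gt_eqF//.
case: ifP => _; last by rewrite mule0.
rewrite -!EFinB -EFinM; congr EFin; field; lra.
Qed.

Lemma ge0_integral_scale s (f : R -> \bar R) : 0 < s ->
  measurable_fun setT f -> (forall x, 0 <= f x)%E ->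
  (\int[mu]_x f x = s%:E * \int[mu]_x f (s * x)%R)%E.
Proof.
move=> s0 mf f0.
have mphi : measurable_fun setT ( *%R s : measurableTypeR R -> measurableTypeR R).
  exact: measurable_funM.
have s0' : 0 <= s by exact: ltW.
pose g : {mfun measurableTypeR R >-> measurableTypeR R} :=
  HB.pack ( *%R s : measurableTypeR R -> measurableTypeR R) (isMeasurableFun.Build _ _ _ _ _ mphi).
rewrite (eq_measure_integral (mscale (NngNum s0') (pushforward mu g))); last first.
  by move=> A mA _; rewrite [LHS](lebesgue_measure_scale s0).
rewrite ge0_integral_mscale//=.
by rewrite ge0_integral_pushforward.
Qed.

(* The test on the sign is needed because powR has the value 1 at negative bases. *)
Definition pow_weight p x : R := if 0 <= x then x `^ (p - 1) else 0.

Lemma pow_weight_ge0 p x : 0 <= pow_weight p x.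
Proof. by rewrite /pow_weight; case: ifP => // _; rewrite powR_ge0. Qed.

Lemma measurable_pow_weight p : measurable_fun setT (pow_weight p).
Proof.
apply: measurable_fun_ifT => //.
  exact: measurable_fun_ler.
Qed.

Lemma pow_weightS p x : 0 < p -> pow_weight (p + 1) x = x * pow_weight p x.
Proof.
move=> p0; rewrite /pow_weight; case: ifPn => x0; last by rewrite mulr0.
by rewrite addrK mulr_powRB1.
Qed.

Lemma pow_weightM p s x : 0 < s -> pow_weight p (s * x) = s `^ (p - 1) * pow_weight p x.
Proof.
move=> s0; rewrite /pow_weight pmulr_rge0//; case: ifPn => x0; last by rewrite mulr0.
by rewrite powRM// ltW.
Qed.

(* Extended-real valued: the recurrences below hold without proving that the
   integral is finite. *)
Definition beta_integral p q : \bar R :=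
  (\int[mu]_x (pow_weight p x * pow_weight q (1 - x)%R)%:E)%E.

Lemma measurable_beta_integrand p q s :
  measurable_fun setT (fun x => (pow_weight p x * pow_weight q (s - x))%:E).
Proof.
apply/measurable_EFinP/measurable_funM; first exact: measurable_pow_weight.
by apply: (measurableT_comp (measurable_pow_weight q)); exact: measurable_funB.
Qed.

Lemma beta_integral_ge0 p q : (0 <= beta_integral p q)%E.
Proof. by apply: integral_ge0 => x _; rewrite lee_fin mulr_ge0 ?pow_weight_ge0. Qed.

Lemma integral_pow_weight p q s : s != 0 ->
  (\int[mu]_x (pow_weight p x * pow_weight q (s - x)%R)%:E =
   beta_integral p q * (pow_weight (p + q) s)%:E)%E.
Proof.
rewrite neq_lt => /orP[s0|s0].
  rewrite [X in (_ * X%:E)%E]/pow_weight leNgt s0 mule0.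
  rewrite integral0_eq// => x _.
  rewrite /pow_weight; case: ifPn => x0; last by rewrite mul0r.
  by rewrite subr_ge0 leNgt (lt_le_trans s0 x0) mulr0.
rewrite (ge0_integral_scale s0); last 2 first.
- exact: measurable_beta_integrand.
- by move=> x; rewrite lee_fin mulr_ge0 ?pow_weight_ge0.
under eq_integral => x _.
  rewrite (_ : s - s * x = s * (1 - x)); last by ring.
  rewrite !pow_weightM// (_ : _ * _ = (s `^ (p - 1) * s `^ (q - 1)) *
    (pow_weight p x * pow_weight q (1 - x))); last by ring.
  rewrite EFinM.
  over.
rewrite ge0_integralZl//=; last 3 first.
- exact: measurable_beta_integrand.
- by move=> x _; rewrite lee_fin mulr_ge0 ?pow_weight_ge0.
- by rewrite lee_fin mulr_ge0 ?powR_ge0.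
rewrite muleA -EFinM muleC; congr (_ * _%:E)%E.
rewrite /pow_weight (ltW s0).
rewrite -{1}(powRr1 (ltW s0)) -!powRD ?(gt_eqF s0)//; first by congr (_ `^ _); ring.
all: by rewrite implybT.
Qed.

Lemma beta_integral_split p q : 0 < p -> 0 < q ->
  (beta_integral (p + 1) q + beta_integral p (q + 1) = beta_integral p q)%E.
Proof.
move=> p0 q0; rewrite /beta_integral -ge0_integralD//; last 4 first.
- by move=> x _; rewrite lee_fin mulr_ge0 ?pow_weight_ge0.
- exact: measurable_beta_integrand.
- by move=> x _; rewrite lee_fin mulr_ge0 ?pow_weight_ge0.
- exact: measurable_beta_integrand.
by apply: eq_integral => x _; rewrite !pow_weightS// -EFinD; congr EFin; ring.
Qed.

End beta_integrals.

Section beta_recurrence.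
Context {R : realType}.
Local Notation mu := (@lebesgue_measure R).
Implicit Types (p q s x : R).

Lemma integral_is_derive (F f : R -> R) (a b : R) : a < b ->
  {in `[a, b], forall x, is_derive x 1 F (f x)} ->
  {in `[a, b], forall x, {for x, continuous f}} ->
  (\int[mu]_(x in `[a, b]) (f x)%:E = (F b - F a)%:E)%E.
Proof.
move=> ab dF cf.
have cF x : x \in `[a, b] -> {for x, continuous F}.
  move=> xab; apply/differentiable_continuous/derivable1_diffP.
  by have [] := dF x xab.
have aab : a \in `[a, b] by rewrite in_itv/= lexx ltW.
have bab : b \in `[a, b] by rewrite in_itv/= lexx ltW.
rewrite (continuous_FTC2 ab (F := F))//.
- by apply: continuous_in_subspaceT => x /set_mem; exact: cf.
- split.
  + move=> x xab; have [] := dF x => //.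
    by move: xab; rewrite !in_itv/= => /andP[/ltW-> /ltW->].
  + exact/cvg_at_right_filter/cF.
  + exact/cvg_at_left_filter/cF.
- move=> x xab; rewrite derive1E; have [] := dF x => //.
  by move: xab; rewrite !in_itv/= => /andP[/ltW-> /ltW->].
Qed.

Lemma continuous_powR p x : 0 < x -> {for x, continuous (@powR R ^~ p)}.
Proof.
move=> x0; apply/differentiable_continuous/derivable1_diffP.
by apply: derivable_powR; rewrite in_itv/= andbT.
Qed.

Lemma continuous_powRB p x : x < 1 -> {for x, continuous (fun y : R => (1 - y) `^ p)}.
Proof.
move=> x1; apply: (@continuous_comp _ _ _ (fun y : R => 1 - y) (@powR R ^~ p)).
  by apply: (@cvgB _ R^o); [exact: cvg_cst|exact: cvg_id].
by apply: continuous_powR; rewrite subr_gt0.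
Qed.

Lemma beta_integral_itv p q :
  (beta_integral p q = \int[mu]_(x in `]0%R, 1%R[) (x `^ (p - 1) * (1 - x)%R `^ (q - 1))%:E)%E.
Proof.
rewrite /beta_integral.
have -> : (fun x : measurableTypeR R => (pow_weight p x * pow_weight q (1 - x))%:E) =
   (fun x : R => (x `^ (p - 1) * (1 - x)%R `^ (q - 1))%:E) \_ `[0, 1].
  apply/funext => x; rewrite patchE /pow_weight subr_ge0 mem_setE in_itv/=.
  by case: ifP => x0 /=; [case: ifP => _; rewrite ?mulr0|rewrite mul0r].
rewrite -integral_mkcond integral_itv_bndoo//.
apply/measurable_EFinP/measurable_funTS/measurable_funM => //.
by apply: (measurableT_comp (@measurable_powR R (q - 1))); exact: measurable_funB.
Qed.

Lemma powR_itv_cvg0 (p q : R) (e : nat -> R) : 0 < p -> (forall n, 0 < e n) ->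
  e n @[n --> \oo] --> 0 -> (e n) `^ p * (1 - e n) `^ q @[n --> \oo] --> 0.
Proof.
move=> p0 e0 ecv.
have h : x `^ p * (1 - x) `^ q @[x --> 0^'+] --> 0.
  have : x `^ p * (1 - x) `^ q @[x --> 0^'+] --> 0 * (1 - 0) `^ q.
    apply: cvgM; first exact: powR_cvg0.
    by apply: cvg_at_right_filter; apply: continuous_powRB.
  by rewrite mul0r.
by move/cvg_at_rightP : h; apply; split.
Qed.

(* The integrands may be unbounded at 0 and 1, so the fundamental theorem of
   calculus is applied on intervals exhausting ]0, 1[. *)
Definition shrink n : R := (n.+3%:R)^-1.
Definition shrink_itv n : set R := `[shrink n, 1 - shrink n]%classic.

Lemma shrink_gt0 n : 0 < shrink n. Proof. by rewrite invr_gt0. Qed.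

Lemma shrink_lt n : shrink n < 1 - shrink n.
Proof.
have h : shrink n < 2^-1 by rewrite /shrink ltf_pV2 ?posrE ?ltr_nat.
lra.
Qed.

Lemma shrink_cvg : shrink n @[n --> \oo] --> 0.
Proof.
have := @cvg_harmonic R.
rewrite -(cvg_shiftn 2) /=; apply: cvg_trans; apply: near_eq_cvg; near=> n.
by rewrite /shrink addn2.
Unshelve. all: by end_near. Qed.

Lemma shrink_itv_nd : nondecreasing_seq shrink_itv.
Proof.
move=> n k nk; apply/subsetPset => x; rewrite /shrink_itv/= !in_itv/= => /andP[h1 h2].
have h : shrink k <= shrink n by rewrite /shrink lef_pV2 ?posrE// ler_nat !ltnS.
by rewrite (le_trans h h1) (le_trans h2)// lerB.
Qed.

Lemma shrink_itv_bigcup : \bigcup_n shrink_itv n = `]0, 1[%classic.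
Proof.
apply/seteqP; split => x.
  move=> [n _]; rewrite /shrink_itv/= !in_itv/= => /andP[h1 h2].
  rewrite (lt_le_trans (shrink_gt0 n) h1)/= (le_lt_trans h2)//.
  by rewrite ltrBlDr ltrDl shrink_gt0.
rewrite /= in_itv/= => /andP[x0 x1].
have m0 : 0 < Num.min x (1 - x) by rewrite lt_min x0 subr_gt0.
have /cvgr0Pnorm_lt /(_ _ m0)[N _ HN] := shrink_cvg.
exists N => //; rewrite /shrink_itv/= in_itv/=.
have := HN N (leqnn _) => /=; rewrite gtr0_norm ?shrink_gt0// lt_min => /andP[h1 h2].
by rewrite (ltW h1)/= lerBrDl -lerBrDr ltW.
Qed.

Lemma beta_integral_cvg p q :
  (\int[mu]_(x in shrink_itv n) (x `^ (p - 1) * (1 - x)%R `^ (q - 1))%:E @[n --> \oo]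
     --> beta_integral p q)%E.
Proof.
rewrite beta_integral_itv -shrink_itv_bigcup.
apply: ge0_nondecreasing_set_cvg_integral.
- exact: shrink_itv_nd.
- by move=> n; exact: measurable_itv.
- move=> n; apply/measurable_EFinP/measurable_funTS/measurable_funM => //.
  by apply: (measurableT_comp (@measurable_powR R (q - 1))); exact: measurable_funB.
- by move=> n x _; rewrite lee_fin mulr_ge0 ?powR_ge0.
Qed.

Lemma beta_integral_parts p q : 0 < p -> 0 < q ->
  (p%:E * beta_integral p (q + 1) = q%:E * beta_integral (p + 1) q)%E.
Proof.
move=> p0 q0.
pose u x := x `^ (p - 1) * (1 - x) `^ (q + 1 - 1).
pose v x := x `^ (p + 1 - 1) * (1 - x) `^ (q - 1).
pose F x := x `^ p * (1 - x) `^ q.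
have in01 n x : x \in `[shrink n, 1 - shrink n] -> 0 < x < 1.
  rewrite in_itv/= => /andP[h1 h2].
  rewrite (lt_le_trans (shrink_gt0 n) h1) (le_lt_trans h2)//.
  by rewrite ltrBlDr ltrDl shrink_gt0.
have cu n x : x \in `[shrink n, 1 - shrink n] -> {for x, continuous u}.
  move=> /in01/andP[h1 h2].
  by apply: cvgM; [exact: continuous_powR|exact: continuous_powRB].
have cv n x : x \in `[shrink n, 1 - shrink n] -> {for x, continuous v}.
  move=> /in01/andP[h1 h2].
  by apply: cvgM; [exact: continuous_powR|exact: continuous_powRB].
have iu n : mu.-integrable (shrink_itv n) (EFin \o u).
  apply: continuous_compact_integrable; first exact: segment_compact.
  by apply: continuous_in_subspaceT => x /set_mem; exact: cu.
have iv n : mu.-integrable (shrink_itv n) (EFin \o v).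
  apply: continuous_compact_integrable; first exact: segment_compact.
  by apply: continuous_in_subspaceT => x /set_mem; exact: cv.
have E n : (p%:E * \int[mu]_(x in shrink_itv n) (u x)%:E =
   q%:E * \int[mu]_(x in shrink_itv n) (v x)%:E + (F (1 - shrink n) - F (shrink n))%:E)%E.
  rewrite -(@integral_is_derive F (fun x => p * u x - q * v x))//; last 3 first.
  - exact: shrink_lt.
  - move=> x xI; have /andP[x0 x1] := in01 _ _ xI.
    have d1 : is_derive x 1 (fun y : R => (1 - y) `^ q) (q * (1 - x) `^ (q - 1) * -1).
      apply: (@is_derive1_comp _ (@powR R ^~ q) (fun y : R => 1 - y)).
        by apply: is_derive1_powR; rewrite subr_gt0.
      have h := @is_deriveB R R R (cst 1) id x 1 0 1
        (@is_derive_cst R R R 1 x 1) (@is_derive_id R R x 1).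
      by move: h; rewrite sub0r.
    have d2 := is_derive1_powR p x0.
    apply: (is_derive_eq (is_deriveM d2 d1)).
    by rewrite /u /v !addrK /= /GRing.scale/=; ring.
  - move=> x xI; apply: (@cvgB _ R^o).
      by apply: (@cvgM R); [exact: cvg_cst|exact: (cu _ _ xI)].
    by apply: (@cvgM R); [exact: cvg_cst|exact: (cv _ _ xI)].
  have -> : (\int[mu]_(x in `[shrink n, (1 - shrink n)%R]) (p * u x - q * v x)%:E =
     \int[mu]_(x in shrink_itv n) (((fun x => p%:E * (u x)%:E) \- (fun x => q%:E * (v x)%:E)) x))%E by [].
  have mI : measurable (shrink_itv n) by exact: measurable_itv.
  rewrite integralB//; last 2 first.
    exact: integrableZl.
    exact: integrableZl.
  rewrite !integralZl//= addeC subeK//.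
  by rewrite fin_numM// integrable_fin_num.
have Fcv : F (1 - shrink n) - F (shrink n) @[n --> \oo] --> 0.
  rewrite -[X in _ --> X](subrr 0); apply: (@cvgB _ R^o); last first.
    by apply: powR_itv_cvg0 => //; [exact: shrink_gt0|exact: shrink_cvg].
  rewrite [X in X @ _ --> _](_ : _ = fun n => shrink n `^ q * (1 - shrink n) `^ p); last first.
    by apply/funext => n; rewrite /F subKr mulrC.
  by apply: powR_itv_cvg0 => //; [exact: shrink_gt0|exact: shrink_cvg].
have c1 := cvgeZl (y := p%:E) isT (@beta_integral_cvg p (q + 1)).
have c2 := cvgeZl (y := q%:E) isT (@beta_integral_cvg (p + 1) q).
have c3 : ((F (1 - shrink n) - F (shrink n))%:E @[n --> \oo] --> 0%:E)%E.
  by apply: cvg_EFin => //; exact: nearW.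
have c4 := cvgeD (fin_num_adde_defl (y := 0%:E) _ isT) c2 c3.
move: c1; under eq_fun do rewrite E.
by move=> c1; rewrite -[LHS](cvg_lim _ c1)// -[RHS]adde0; exact: (cvg_lim _ (c4 _)).
Qed.

Lemma beta_integral_succ p q : 0 < p -> 0 < q ->
  beta_integral (p + 1) q = ((p / (p + q))%:E * beta_integral p q)%E.
Proof.
move=> p0 q0; have := beta_integral_parts p0 q0; rewrite -(beta_integral_split p0 q0).
have := beta_integral_ge0 (p + 1) q; have := beta_integral_ge0 p (q + 1).
have pq : p + q != 0 by lra.
have q1 : q != 0 by lra.
have pq0 : 0 < p / (p + q) by rewrite divr_gt0// addr_gt0.
case: (beta_integral p (q + 1)) => [y| |] //; case: (beta_integral (p + 1) q) => [x| |] //= _ _.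
- rewrite -?EFinD -!EFinM => -[h]; congr EFin.
  have -> : y = q * x / p by rewrite -h; field; lra.
  by field; rewrite pq; lra.
- by move=> _; rewrite addye// gt0_muley.
- by rewrite gt0_muley// -EFinM.
- by move=> _; rewrite addye// gt0_muley.
Qed.

Definition rising p (n : nat) : R := \prod_(i < n) (p + i%:R).

Lemma rising_gt0 p n : 0 < p -> 0 < rising p n.
Proof. by move=> p0; apply: prodr_gt0 => i _; rewrite ltr_wpDr. Qed.

Lemma beta_integral_succr p q : 0 < p -> 0 < q ->
  beta_integral p (q + 1) = ((q / (p + q))%:E * beta_integral p q)%E.
Proof.
move=> p0 q0; have := beta_integral_parts p0 q0; rewrite beta_integral_succ// => h.
have : (p^-1%:E * (p%:E * beta_integral p (q + 1)) =
    p^-1%:E * (q%:E * ((p / (p + q))%:E * beta_integral p q)))%E.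
  by rewrite h.
rewrite !muleA -!EFinM mulVf ?gt_eqF// mul1e => ->; congr (_%:E * _)%E.
by field; lra.
Qed.

Lemma beta_integral_rising p q n k : 0 < p -> 0 < q ->
  beta_integral (p + n%:R) (q + k%:R) =
  ((rising p n * rising q k / rising (p + q) (n + k))%:E * beta_integral p q)%E.
Proof.
move=> p0 q0; have pn i : 0 < p + i%:R by rewrite ltr_wpDr.
have qn i : 0 < q + i%:R by rewrite ltr_wpDr.
have rS r i : rising r i.+1 = rising r i * (r + i%:R) by rewrite /rising big_ord_recr.
have rgt r i : 0 < r -> rising r i != 0 by move=> r0; rewrite gt_eqF// rising_gt0.
elim: n => [|n IH].
  rewrite addr0 add0n [rising p 0]big_ord0 mul1r.
  elim: k => [|k IH]; first by rewrite /rising !big_ord0 divr1 mul1e addr0.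
  rewrite -natr1 addrA beta_integral_succr// IH muleA -EFinM !rS; congr (_%:E * _)%E.
  have h1 := rgt (p + q) k (addr_gt0 p0 q0).
  have h2 : p + q + k%:R != 0 by rewrite gt_eqF// ltr_wpDr// addr_gt0.
  by field; rewrite h1 h2.
rewrite -natr1 addrA beta_integral_succ// IH muleA -EFinM addSn !rS; congr (_%:E * _)%E.
have h1 := rgt (p + q) (n + k)%N (addr_gt0 p0 q0).
have h2 : p + q + (n + k)%:R != 0 by rewrite gt_eqF// ltr_wpDr// addr_gt0.
rewrite natrD in h2 *.
have h3 : p + n%:R + (q + k%:R) != 0 by rewrite gt_eqF// addr_gt0.
by field; rewrite h1/= h2.
Qed.

End beta_recurrence.

(** * Functionals that behave like the integral of nonnegative functions *)

Import HBNNSimple.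

Section ge0_functionals.
Context {R : realType}.
Local Open Scope ereal_scope.

Definition ge0_functional d (T : measurableType d) (Phi : (T -> \bar R) -> \bar R) :=
  [/\ forall f, (forall x, 0 <= f x) -> 0 <= Phi f,
      forall f g, measurable_fun setT f -> measurable_fun setT g ->
        (forall x, 0 <= f x) -> (forall x, 0 <= g x) ->
        Phi (fun x => f x + g x) = Phi f + Phi g,
      forall (c : R) f, (0 <= c)%R -> measurable_fun setT f -> (forall x, 0 <= f x) ->
        Phi (fun x => c%:E * f x) = c%:E * Phi f &
      forall f : nat -> T -> \bar R, (forall n, measurable_fun setT (f n)) ->
        (forall n x, 0 <= f n x) -> (forall x, nondecreasing_seq (f ^~ x)) ->
        Phi (f n) @[n --> \oo] --> Phi (fun x => limn (f ^~ x))].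

Lemma ge0_functional_eq d (T : measurableType d) (Phi Psi : (T -> \bar R) -> \bar R) :
  ge0_functional Phi -> ge0_functional Psi ->
  (forall B, measurable B -> Phi (fun x => (\1_B x)%:E) = Psi (fun x => (\1_B x)%:E)) ->
  forall f, measurable_fun setT f -> (forall x, 0 <= f x) -> Phi f = Psi f.
Proof.
move=> [_ PhiD PhiZ Philim] [_ PsiD PsiZ Psilim] h f mf f0.
have step (J : choiceType) (s : seq J) (a : J -> R) (B : J -> set T) :
    (forall j, measurable (B j)) -> (forall j, (0 <= a j)%R) ->
    Phi (fun x => \sum_(j <- s) (a j * \1_(B j) x)%:E) =
    Psi (fun x => \sum_(j <- s) (a j * \1_(B j) x)%:E).
  move=> mB a0.
  have mi j : measurable_fun setT (fun x : T => (\1_(B j) x)%:E : \bar R).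
    exact/measurable_EFinP/measurable_indic.
  have m1 j : measurable_fun setT (fun x : T => (a j * \1_(B j) x)%:E).
    by apply/measurable_EFinP/measurable_funM => //; exact: measurable_indic.
  have p1 j x : 0 <= (a j * \1_(B j) x)%:E by rewrite lee_fin mulr_ge0// indicE.
  elim: s => [|j s IH].
    under eq_fun do rewrite big_nil.
    have e : (fun=> 0) = (fun x : T => 0%:E * (\1_(@setT T) x)%:E) :> (T -> \bar R).
      by apply/funext => x; rewrite mul0e.
    by rewrite e PhiZ ?PsiZ ?mul0e//; exact/measurable_EFinP/measurable_indic.
  under eq_fun do rewrite big_cons.
  have m2 : measurable_fun setT (fun x : T => \sum_(j <- s) (a j * \1_(B j) x)%:E).
    exact: emeasurable_sum.
  have p2 x : 0 <= \sum_(j <- s) (a j * \1_(B j) x)%:E by apply: sume_ge0.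
  rewrite PhiD// PsiD// IH; congr (_ + _).
  have e : (fun x : T => (a j * \1_(B j) x)%:E) = (fun x => (a j)%:E * (\1_(B j) x)%:E).
    by apply/funext => x; rewrite EFinM.
  rewrite e PhiZ// ?PsiZ// ?h//.
have simple (g : {nnsfun T >-> R}) : Phi (EFin \o g) = Psi (EFin \o g).
  pose s := fset_set (range g).
  have e : EFin \o g = fun x => \sum_(y <- s) (`|y|%R * \1_(g @^-1` [set y]) x)%:E.
    apply/funext => x /=; rewrite fimfunE fsbig_finite//= -sumEFin big_seq [RHS]big_seq.
    apply: eq_bigr => y; rewrite in_fset_set// inE => -[z _ <-].
    by rewrite ger0_norm.
  by rewrite e step.
pose g := nnsfun_approx measurableT mf.
have gf : f = (fun x => limn (EFin \o (g ^~ x))).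
  by apply/funext => x; apply/esym/cvg_lim => //; exact: cvg_nnsfun_approx.
have gE : (fun n => Phi (EFin \o g n)) = (fun n => Psi (EFin \o g n)) by apply/funext.
have c1 := Philim (fun n => EFin \o g n).
have c2 := Psilim (fun n => EFin \o g n).
have mg n : measurable_fun setT (EFin \o g n) by exact/measurable_EFinP.
have g0 n x : 0 <= (EFin \o g n) x by rewrite lee_fin.
have ndg x : nondecreasing_seq ((fun n => EFin \o g n) ^~ x).
  by move=> k l kl; rewrite lee_fin; exact/lefP/nd_nnsfun_approx.
move: {c1} (c1 mg g0 ndg) {c2} (c2 mg g0 ndg); rewrite -gf gE => c1 c2.
by rewrite -[LHS](cvg_lim _ c1)// -[RHS](cvg_lim _ c2).
Qed.

Lemma ge0_functional_integral d (T : measurableType d) (mu : {measure set T -> \bar R}) :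
  ge0_functional (fun f => \int[mu]_x f x).
Proof.
split.
- by move=> f f0; exact: integral_ge0.
- by move=> f g mf mg f0 g0; rewrite ge0_integralD.
- by move=> c f c0 mf f0; rewrite ge0_integralZl.
- move=> f mf f0 ndf; exact: cvg_monotone_convergence.
Qed.

Lemma ge0_functional_comp d (T : measurableType d) d' (T' : measurableType d')
    (Phi : (T -> \bar R) -> \bar R) (phi : T -> T') (w : T -> R) :
  measurable_fun setT phi -> measurable_fun setT w -> (forall x, (0 <= w x)%R) ->
  ge0_functional Phi ->
  ge0_functional (fun f : T' -> \bar R => Phi (fun x => (w x)%:E * f (phi x))).
Proof.
move=> mphi mw w0 [Phi0 PhiD PhiZ Philim].
have mwf f : measurable_fun setT f -> measurable_fun setT (fun x => (w x)%:E * f (phi x)).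
  move=> mf; apply: emeasurable_funM; first exact/measurable_EFinP.
  exact: measurableT_comp.
split.
- by move=> f f0; apply: Phi0 => x; rewrite mule_ge0// lee_fin.
- move=> f g mf mg f0 g0; rewrite -PhiD//; last 4 first.
  + exact: mwf.
  + exact: mwf.
  + by move=> x; rewrite mule_ge0// lee_fin.
  + by move=> x; rewrite mule_ge0// lee_fin.
  by congr Phi; apply/funext => x; rewrite ge0_muleDr.
- move=> c f c0 mf f0; rewrite -PhiZ//; last 2 first.
  + exact: mwf.
  + by move=> x; rewrite mule_ge0// lee_fin.
  by congr Phi; apply/funext => x; rewrite muleCA.
- move=> f mf f0 ndf.
  have -> : (fun x => (w x)%:E * limn (f ^~ (phi x))) =
            (fun x => limn (fun n => (w x)%:E * f n (phi x))).
    apply/funext => x; apply/esym/cvg_lim => //; apply: cvgeZl => //.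
    exact: ereal_nondecreasing_is_cvgn.
  apply: Philim.
  + by move=> n; exact: mwf.
  + by move=> n x; rewrite mule_ge0// lee_fin.
  + by move=> x k l kl; rewrite lee_wpmul2l ?lee_fin//; exact: ndf.
Qed.

Lemma lebesgue_iint_ge0 k (f : k.-tuple R -> \bar R) :
  (forall t, 0 <= f t) -> 0 <= lebesgue_iint f.
Proof.
by elim: k f => [|k IH] f f0 //=; apply: integral_ge0 => x _; exact: IH.
Qed.

Lemma measurable_lebesgue_iint k d (Y : measurableType d) (f : Y * k.-tuple R -> \bar R) :
  measurable_fun setT f -> (forall z, 0 <= f z) ->
  measurable_fun setT (fun y => lebesgue_iint (fun t => f (y, t))).
Proof.
elim: k d Y f => [|k IH] d Y f mf f0 /=.
  by apply: (measurableT_comp mf); exact: measurable_fun_pair.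
pose g (z : Y * measurableTypeR R) :=
  lebesgue_iint (fun t : k.-tuple R => f (z.1, cons_tuple z.2 t)).
have mg : measurable_fun setT g.
  apply: (IH _ _ (fun z : (Y * measurableTypeR R) * k.-tuple R =>
    f (z.1.1, cons_tuple z.1.2 z.2))) => //.
  apply: (measurableT_comp mf); apply: measurable_fun_pair => /=.
    by apply: measurableT_comp.
  by apply: measurable_cons => //; apply: measurableT_comp.
apply: (@measurable_fun_fubini_tonelli_F _ _ _ _ _ lebesgue_measure g) => //.
by move=> z; exact: lebesgue_iint_ge0.
Qed.

Lemma measurable_comp_cons_tuple k (f : k.+1.-tuple R -> \bar R) x :
  measurable_fun setT f -> measurable_fun setT (fun t : k.-tuple R => f (cons_tuple x t)).
Proof. by move=> mf; apply: (measurableT_comp mf); exact: measurable_cons. Qed.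

Lemma measurable_lebesgue_iint_cons k (f : k.+1.-tuple R -> \bar R) :
  measurable_fun setT f -> (forall t, 0 <= f t) ->
  measurable_fun setT
    (fun x : measurableTypeR R => lebesgue_iint (fun t : k.-tuple R => f (cons_tuple x t))).
Proof.
move=> mf f0; apply: (measurable_lebesgue_iint
  (f := fun z : measurableTypeR R * k.-tuple R => f (cons_tuple z.1 z.2))) => //.
by apply: (measurableT_comp mf); apply: measurable_cons.
Qed.

Lemma le_lebesgue_iint k (f g : k.-tuple R -> \bar R) :
  measurable_fun setT f -> measurable_fun setT g -> (forall t, 0 <= f t) ->
  (forall t, f t <= g t) -> lebesgue_iint f <= lebesgue_iint g.
Proof.
elim: k f g => [|k IH] f g mf mg f0 fg //=.
have g0 t : 0 <= g t by exact: le_trans (fg t).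
apply: ge0_le_integral => //; try exact: measurable_lebesgue_iint_cons.
- by move=> x _; exact: lebesgue_iint_ge0.
- by move=> x _; apply: IH => //; exact: measurable_comp_cons_tuple.
Qed.

Lemma ge0_functional_lebesgue_iint k : ge0_functional (@lebesgue_iint R k).
Proof.
elim: k => [|k IH].
  split => //= f mf f0 ndf.
  exact: ereal_nondecreasing_is_cvgn.
case: IH => [Phi0 PhiD PhiZ Philim].
split => /=.
- by move=> f f0; apply: integral_ge0 => x _; exact: lebesgue_iint_ge0.
- move=> f g mf mg f0 g0.
  rewrite -ge0_integralD//; try exact: measurable_lebesgue_iint_cons.
  + apply: eq_integral => x _.
    by apply: PhiD => //; exact: measurable_comp_cons_tuple.
  + by move=> x _; exact: lebesgue_iint_ge0.
  + by move=> x _; exact: lebesgue_iint_ge0.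
- move=> c f c0 mf f0.
  rewrite -ge0_integralZl//; try exact: measurable_lebesgue_iint_cons.
  + apply: eq_integral => x _.
    by apply: PhiZ => //; exact: measurable_comp_cons_tuple.
  + by move=> x _; exact: lebesgue_iint_ge0.
- move=> f mf f0 ndf.
  have cvx x : lebesgue_iint (fun t : k.-tuple R => f n (cons_tuple x t)) @[n --> \oo] -->
     lebesgue_iint (fun t : k.-tuple R => limn (fun n => f n (cons_tuple x t))).
    by apply: Philim => // n; exact: measurable_comp_cons_tuple.
  have e x : lebesgue_iint (fun t : k.-tuple R => limn (fun n => f n (cons_tuple x t))) =
     limn (fun n => lebesgue_iint (fun t : k.-tuple R => f n (cons_tuple x t))).
    by apply/esym/cvg_lim => //; exact: cvx.
  under [X in _ --> X]eq_integral do rewrite e.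
  apply: cvg_monotone_convergence => //.
  + by move=> n; exact: measurable_lebesgue_iint_cons.
  + by move=> n x _; exact: lebesgue_iint_ge0.
  + move=> x _ n l nl; apply: le_lebesgue_iint => //; try exact: measurable_comp_cons_tuple.
    by move=> t; exact: ndf.
Qed.

End ge0_functionals.

(** * Moments of the Dirichlet distribution *)

Section dirichlet_moments.
Context {R : realType}.
Local Notation mu := (@lebesgue_measure R).
Implicit Types (al : nat -> R) (be s : R).

Fixpoint dirichlet_const k al be : \bar R :=
  if k is k'.+1 then
    (dirichlet_const k' (fun i => al i.+1) be *
     beta_integral (al 0%N) (\sum_(i < k') al i.+1 + be)%R)%E
  else 1%E.

Lemma dirichlet_const_ge0 k al be : (0 <= dirichlet_const k al be)%E.
Proof. by elim: k al => [//|k IH] al /=; rewrite mule_ge0// beta_integral_ge0. Qed.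

Lemma measurable_prod_pow_weight k al be s :
  measurable_fun setT (fun t : k.-tuple R =>
    (\prod_(i < k) pow_weight (al i) (tnth t i) * pow_weight be (s - \sum_(i < k) tnth t i))%:E).
Proof.
apply/measurable_EFinP/measurable_funM.
  apply: measurable_prod => i _.
  exact: measurableT_comp (measurable_pow_weight _) (measurable_tnth _).
apply: (measurableT_comp (measurable_pow_weight _)); apply: measurable_funB => //.
by apply: measurable_sum => i; exact: measurable_tnth.
Qed.

Lemma prod_pow_weight_ge0 k al be s (t : k.-tuple R) :
  0 <= \prod_(i < k) pow_weight (al i) (tnth t i) * pow_weight be (s - \sum_(i < k) tnth t i).
Proof. by rewrite mulr_ge0 ?pow_weight_ge0// prodr_ge0// => i _; exact: pow_weight_ge0. Qed.

Lemma lebesgue_iint_pow_weight k al be s : s != 0 ->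
  lebesgue_iint (fun t : k.-tuple R =>
    (\prod_(i < k) pow_weight (al i) (tnth t i) * pow_weight be (s - \sum_(i < k) tnth t i))%:E) =
  (dirichlet_const k al be * (pow_weight (\sum_(i < k) al i + be) s)%:E)%E.
Proof.
elim: k al s => [|k IH] al s s0.
  by rewrite /= !big_ord0 mul1r subr0 add0r mul1e.
rewrite /=; set A := \sum_(i < k) al i.+1 + be.
pose f (t : k.+1.-tuple R) : \bar R :=
  (\prod_(i < k.+1) pow_weight (al i) (tnth t i) * pow_weight be (s - \sum_(i < k.+1) tnth t i))%:E.
pose g (x : R) : \bar R :=
  (dirichlet_const k (fun i => al i.+1) be * (pow_weight (al 0%N) x * pow_weight A (s - x))%:E)%E.
have mg : measurable_fun setT g.
  by apply: measurable_funeM; exact: measurable_beta_integrand.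
transitivity (\int[mu]_x g x)%E; last first.
  rewrite ge0_integralZl//; last 3 first.
  - exact: measurable_beta_integrand.
  - by move=> x _; rewrite lee_fin mulr_ge0 ?pow_weight_ge0.
  - exact: dirichlet_const_ge0.
  by rewrite integral_pow_weight// muleA big_ord_recl addrA.
apply: ge0_ae_eq_integral => //.
- apply: (measurable_lebesgue_iint_cons (f := f)); first exact: measurable_prod_pow_weight.
  by move=> t; rewrite lee_fin prod_pow_weight_ge0.
- by move=> x _; apply: lebesgue_iint_ge0 => t; rewrite lee_fin prod_pow_weight_ge0.
- by move=> x _; rewrite mule_ge0 ?dirichlet_const_ge0// lee_fin mulr_ge0 ?pow_weight_ge0.
exists [set s]; split => //; first exact: lebesgue_measure_set1.
move=> x /= h; apply: contrapT => /eqP xs; apply: h => _.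
have [_ _ phiZ _] := ge0_functional_lebesgue_iint (R := R) k.
pose h (t : k.-tuple R) :=
  (\prod_(i < k) pow_weight (al i.+1) (tnth t i) *
   pow_weight be (s - x - \sum_(i < k) tnth t i))%:E.
transitivity (lebesgue_iint (fun t => (pow_weight (al 0%N) x)%:E * h t))%E.
  congr lebesgue_iint; apply/funext => t; rewrite -EFinM; congr EFin.
  rewrite !big_ord_recl/= mulrA.
  have e i : tnth (cons_tuple x t) (lift ord0 i) = tnth t i by rewrite !(tnth_nth x).
  rewrite (eq_bigr _ (fun i _ => f_equal (pow_weight (al (lift ord0 i))) (e i))).
  by rewrite (eq_bigr _ (fun i _ => (e i))) opprD addrA.
rewrite phiZ ?pow_weight_ge0//; last 2 first.
- exact: (@measurable_prod_pow_weight k (fun i => al i.+1)).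
- by move=> t; rewrite lee_fin; exact: (@prod_pow_weight_ge0 k (fun i => al i.+1)).
by rewrite (IH (fun i => al i.+1)) ?subr_eq0 1?eq_sym// /g EFinM muleCA.
Qed.

Lemma dirichlet_const_rising k al be (n : nat -> nat) l : (forall i, 0 < al i) -> 0 < be ->
  dirichlet_const k (fun i => al i + (n i)%:R) (be + l%:R) =
  ((\prod_(i < k) rising (al i) (n i) * rising be l /
     rising (\sum_(i < k) al i + be) (\sum_(i < k) n i + l))%:E * dirichlet_const k al be)%E.
Proof.
move=> al0 be0; elim: k al n al0 => [|k IH] al n al0 /=.
  by rewrite !big_ord0 add0r mul1r mule1 add0n divff ?gt_eqF ?rising_gt0.
have s0 : 0 < \sum_(i < k) al i.+1 + be.
  by rewrite ltr_wpDl// sumr_ge0// => i _; exact: ltW.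
rewrite (IH (fun i => al i.+1) (fun i => n i.+1))// big_split/= addrACA.
rewrite -natr_sum -natrD beta_integral_rising//.
rewrite muleACA -EFinM; congr (_%:E * _)%E.
rewrite !big_ord_recl /= -!addrA -!addnA.
by field; rewrite !gt_eqF// rising_gt0// ltr_wpDr// ltW.
Qed.

End dirichlet_moments.

Section dirichlet_law.
Context {R : realType}.
Variables (k : nat) (al : nat -> R).
Hypothesis al0 : forall i, 0 < al i.
Let a := (fun i : 'I_k.+1 => al i).
Let Z := Gamma (\sum_(i < k.+1) a i) / (\prod_(i < k.+1) Gamma (a i)).
Let w (t : k.-tuple R) :=
  \1_(@simplex R k.+1) (@complete_tuple R k.+1 t) * dirichlet_pdf a (@complete_tuple R k.+1 t).

Lemma Gamma_ge0 x : 0 <= Gamma x :> R.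
Proof.
by apply: Rintegral_ge0 => y _; rewrite mulr_ge0 ?powR_ge0 ?expR_ge0.
Qed.

Lemma tnth_complete_widen (t : k.-tuple R) (i : 'I_k) :
  tnth (@complete_tuple R k.+1 t) (widen_ord (leqnSn k) i) = tnth t i.
Proof. by rewrite tnth_mktuple /= -tnth_nth. Qed.

Lemma tnth_complete_max (t : k.-tuple R) :
  tnth (@complete_tuple R k.+1 t) ord_max = 1 - \sum_(i < k) tnth t i.
Proof. by rewrite tnth_mktuple nth_default// size_tuple. Qed.

Lemma sum_complete (t : k.-tuple R) :
  \sum_(i < k.+1) tnth (@complete_tuple R k.+1 t) i = 1.
Proof.
rewrite big_ord_recr/= tnth_complete_max.
under eq_bigr do rewrite tnth_complete_widen.
by rewrite addrC subrK.
Qed.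

Lemma dirichlet_densityE t :
  w t = Z * \prod_(i < k.+1) pow_weight (al i) (tnth (@complete_tuple R k.+1 t) i).
Proof.
rewrite /w /dirichlet_pdf -/Z; set c : k.+1.-tuple R := @complete_tuple R k.+1 t.
rewrite mulrCA; congr (_ * _).
rewrite indicE; have [cS|cS] := boolP (c \in @simplex R k.+1).
  rewrite mul1r; apply: eq_bigr => i _; rewrite /pow_weight.
  by move: cS; rewrite inE => -[-> _].
rewrite mul0r; have [i ci] : exists i, ~ 0 <= tnth c i.
  apply/existsNP => h; move/negP : cS; apply; rewrite inE; split => //.
  exact: sum_complete.
by rewrite (bigD1 i)//= {1}/pow_weight (negbTE (introN idP ci)) mul0r.
Qed.

Lemma measurable_complete_tuple :
  measurable_fun setT (fun t : k.-tuple R => @complete_tuple R k.+1 t).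
Proof.
apply/measurable_fun_tnthP => i; have [j ->|->] := unliftP ord_max i.
  have -> : lift ord_max j = widen_ord (leqnSn k) j.
    by apply/val_inj; rewrite /= /bump leqNgt ltn_ord.
  rewrite (_ : _ \o _ = (fun t : k.-tuple R => tnth t j)); first exact: measurable_tnth.
  by apply/funext => t /=; rewrite tnth_complete_widen.
rewrite (_ : _ \o _ = (fun t : k.-tuple R => 1 - \sum_(i < k) tnth t i)).
  by apply: measurable_funB => //; apply: measurable_sum => j; exact: measurable_tnth.
by apply/funext => t /=; rewrite tnth_complete_max.
Qed.

Lemma dirichlet_density_ge0 t : 0 <= w t.
Proof.
rewrite dirichlet_densityE mulr_ge0//; last by apply: prodr_ge0 => i _; exact: pow_weight_ge0.
by rewrite divr_ge0 ?Gamma_ge0// prodr_ge0// => i _; exact: Gamma_ge0.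
Qed.

Lemma measurable_dirichlet_density : measurable_fun setT w.
Proof.
rewrite (_ : w = fun t => Z *
  \prod_(i < k.+1) pow_weight (al i) (tnth (@complete_tuple R k.+1 t) i)); last first.
  by apply/funext => t; rewrite dirichlet_densityE.
apply: measurable_funM => //; apply: measurable_prod => i _.
apply: (measurableT_comp (measurable_pow_weight _)).
exact: (measurableT_comp (measurable_tnth i) measurable_complete_tuple).
Qed.

Lemma pow_weight_expr p x n : 0 < p -> pow_weight p x * `|x| ^+ n = pow_weight (p + n%:R) x :> R.
Proof.
move=> p0; elim: n => [|n IH]; first by rewrite expr0 mulr1 addr0.
rewrite exprS mulrCA IH -natr1 addrA pow_weightS; last by rewrite ltr_wpDr.
by rewrite /pow_weight; case: ifPn => x0; rewrite ?mulr0// ger0_norm.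
Qed.

Lemma iint_dirichlet_moment (n : nat -> nat) :
  lebesgue_iint (fun t : k.-tuple R => (w t)%:E *
    (\prod_(i < k.+1) `|tnth (@complete_tuple R k.+1 t) i| ^+ n i)%:E)%E =
  (Z%:E * dirichlet_const k (fun i => (al i + (n i)%:R)%R) (al k + (n k)%:R)%R)%E.
Proof.
have [_ _ phiZ _] := ge0_functional_lebesgue_iint (R := R) k.
pose h (t : k.-tuple R) :=
  (\prod_(i < k) pow_weight (al i + (n i)%:R) (tnth t i) *
   pow_weight (al k + (n k)%:R) (1 - \sum_(i < k) tnth t i))%:E.
transitivity (lebesgue_iint (fun t => Z%:E * h t)%E).
  congr lebesgue_iint; apply/funext => t; rewrite -!EFinM; congr EFin.
  rewrite dirichlet_densityE -mulrA -big_split/=; congr (_ * _).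
  under eq_bigr do rewrite pow_weight_expr//.
  rewrite big_ord_recr/= tnth_complete_max.
  by under eq_bigr do rewrite tnth_complete_widen.
rewrite phiZ//; last 3 first.
- by rewrite divr_ge0 ?Gamma_ge0// prodr_ge0// => i _; exact: Gamma_ge0.
- exact: (@measurable_prod_pow_weight _ k (fun i => al i + (n i)%:R)).
- by move=> t; rewrite lee_fin; exact: (@prod_pow_weight_ge0 _ k (fun i => al i + (n i)%:R)).
rewrite (@lebesgue_iint_pow_weight _ k (fun i => al i + (n i)%:R)) ?oner_eq0//.
by rewrite /pow_weight ler01 powR1 mule1.
Qed.

Context d (O : measurableType d) (P : probability O R) (X : {RV P >-> k.+1.-tuple R}).
Hypothesis hX : forall B, measurable B -> distribution P X B = dirichlet a B.

Lemma dirichlet_expectation (f : k.+1.-tuple R -> \bar R) :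
  measurable_fun setT f -> (forall x, 0 <= f x)%E ->
  (\int[P]_x f (X x))%E =
  lebesgue_iint (fun t : k.-tuple R => (w t)%:E * f (@complete_tuple R k.+1 t))%E.
Proof.
move=> mf f0.
have -> : (\int[P]_x f (X x) = \int[distribution P X]_y f y)%E.
  by rewrite ge0_integral_distribution.
have h1 := ge0_functional_integral (distribution P X).
have h2 := ge0_functional_comp measurable_complete_tuple
  measurable_dirichlet_density dirichlet_density_ge0 (ge0_functional_lebesgue_iint k).
apply: (ge0_functional_eq h1 h2) => // B mB.
transitivity (distribution P X B); first by rewrite integral_indic// setIT.
rewrite hX// /dirichlet.
congr lebesgue_iint; apply/funext => t.
by rewrite -EFinM indicI /w /=; congr EFin; ring.
Qed.

Lemma dirichlet_moment (n : nat -> nat) :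
  (\int[P]_x (\prod_(i < k.+1) `|tnth (X x) i| ^+ n i)%:E)%E =
  (\prod_(i < k.+1) rising (al i) (n i) /
     rising (\sum_(i < k.+1) al i) (\sum_(i < k.+1) n i))%:E.
Proof.
pose f (n : nat -> nat) (x : k.+1.-tuple R) := (\prod_(i < k.+1) `|tnth x i| ^+ n i)%:E.
have mf l : measurable_fun setT (f l).
  apply/measurable_EFinP/measurable_prod => i _; apply: measurable_funX.
  exact: measurableT_comp (@normr_measurable _ _) (measurable_tnth i).
have f0 l x : (0 <= f l x)%E by rewrite lee_fin; apply: prodr_ge0 => i _; rewrite exprn_ge0.
have E l := dirichlet_expectation (mf l) (f0 l).
(* A probability with the Dirichlet law exists, so the total mass is 1: the
   Gamma factors need not be evaluated. *)
have : (Z%:E * dirichlet_const k al (al k))%E = 1%E.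
  rewrite -(@probability_setT _ _ _ P).
  have := E (fun=> 0%N); rewrite iint_dirichlet_moment.
  under eq_integral do rewrite /f big1 ?expr0//.
  rewrite integral_cst; last exact: measurableT.
  rewrite mul1e addr0 => ->.
  by congr (_ * dirichlet_const _ _ _)%E; apply/funext => i; rewrite addr0.
move=> h1.
rewrite (E n) iint_dirichlet_moment dirichlet_const_rising// muleCA h1 mule1.
by rewrite !big_ord_recr/=.
Qed.

Lemma measurable_simplex n : measurable (@simplex R n).
Proof.
have -> : @simplex R n = (\bigcap_i (fun x => 0 <= tnth x i) @^-1` [set true]) `&`
    ((fun x => \sum_(i < n) tnth x i) @^-1` [set 1]).
  apply/seteqP; split => x /= [h1 h2]; split => //; first by move=> i _; exact: h1.
  by move=> i; apply: h1.
apply: measurableI.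
  apply: fin_bigcap_measurable => [|i _]; first exact: finite_finset.
  rewrite -[X in measurable X]setTI; apply: measurable_fun_ler => //.
  exact: measurable_tnth.
rewrite -[X in measurable X]setTI; apply: measurable_sum => // i.
exact: measurable_tnth.
Qed.

Lemma dirichlet_ae_simplex : {ae P, forall x, @simplex R k.+1 (X x)}.
Proof.
have mS : measurable (~` @simplex R k.+1) by apply: measurableC; exact: measurable_simplex.
exists (X @^-1` (~` @simplex R k.+1)); split => //.
  by rewrite -[X in measurable X]setTI; exact: measurable_funPT.
have -> : P (X @^-1` (~` @simplex R k.+1)) = distribution P X (~` @simplex R k.+1) by [].
rewrite hX// /dirichlet setICl.
have [Phi0 _ phiZ _] := ge0_functional_lebesgue_iint (R := R) k.
transitivity (lebesgue_iint (fun t : k.-tuple R => 0%R%:E * 0))%E.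
  by congr lebesgue_iint; apply/funext => t; rewrite indic0 mul0r mule0.
by rewrite phiZ// mul0e.
Qed.

End dirichlet_law.

(** * Products of independent functions *)

Section independence.
Context {R : realType} d (O : measurableType d) (P : probability O R).
Context (I : choiceType) d' (T : measurableType d') (X : I -> {RV P >-> T}).
Hypothesis Xind : mutually_independent X.

Let pr i (B : set T) := fine (P (X i @^-1` B)).

Lemma measurable_preimage_RV i (B : set T) : measurable B -> measurable (X i @^-1` B).
Proof. by move=> mB; rewrite -[X in measurable X]setTI; exact: measurable_funPT. Qed.

Lemma independent_integral_indic (s : seq I) (B : I -> set T) :
  uniq s -> (forall i, measurable (B i)) ->
  (\int[P]_x (\prod_(i <- s) \1_(B i) (X i x))%:E = (\prod_(i <- s) pr i (B i))%:E)%E.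
Proof.
move=> us mB.
have -> : (fun x : O => (\prod_(i <- s) \1_(B i) (X i x))%:E) =
   (fun x => (\1_(\bigcap_(i in [set` [fset i in s]%fset]) (X i @^-1` B i)) x)%:E) :> (O -> \bar R).
  apply/funext => x; congr EFin; rewrite indicE.
  have [h|h] := boolP (x \in _).
    rewrite big_seq big1// => i iS; rewrite indicE mem_set//.
    by move: h; rewrite inE => /(_ i); apply; rewrite /= inE.
  have [i iS hi] : exists2 i, i \in s & ~ B i (X i x).
    apply: contrapT => hh; move/negP : h; apply; rewrite inE => i /=; rewrite inE => iS.
    by apply: contrapT => hi; apply: hh; exists i.
  by rewrite (big_rem i)//= indicE memNset ?mul0r.
rewrite integral_indic//; last first.
  by apply: fin_bigcap_measurable => // i _; exact: measurable_preimage_RV.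
rewrite setIT; transitivity (\prod_(i <- [fset i in s]%fset) P (X i @^-1` B i))%E.
  exact: Xind.
transitivity (\prod_(i <- s) P (X i @^-1` B i))%E.
  by apply: perm_big; apply: uniq_perm => // i; rewrite inE.
rewrite -prodEFin; apply: eq_bigr => i _.
by rewrite /pr fineK// fin_num_measure//; exact: measurable_preimage_RV.
Qed.

Lemma independent_expectation (s : seq I) (f : I -> T -> R) (e : I -> R) :
  uniq s -> (forall i, measurable_fun setT (f i)) -> (forall i t, 0 <= f i t) ->
  (forall i, \int[P]_x (f i (X i x))%:E = (e i)%:E)%E ->
  (\int[P]_x (\prod_(i <- s) f i (X i x))%:E = (\prod_(i <- s) e i)%:E)%E.
Proof.
move=> us mf f0 fe.
have e0 i : 0 <= e i.
  by rewrite -lee_fin -fe; apply: integral_ge0 => x _; rewrite lee_fin.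
have mfX i : measurable_fun setT (fun x => f i (X i x)).
  by apply: measurableT_comp => //; exact: measurable_funPT.
suff H s2 (B : I -> set T) : uniq (s ++ s2) -> (forall i, measurable (B i)) ->
  (\int[P]_x (\prod_(i <- s) f i (X i x) * \prod_(i <- s2) \1_(B i) (X i x))%:E =
    (\prod_(i <- s) e i * \prod_(i <- s2) pr i (B i))%:E)%E.
  have := H [::] (fun=> setT); rewrite cats0 => /(_ us (fun=> measurableT)).
  by under eq_integral do rewrite big_nil mulr1; rewrite big_nil mulr1.
elim: s us s2 B => [_|i s IH /= /andP[iNs us]] s2 B us2 mB.
  under eq_integral do rewrite big_nil mul1r.
  by rewrite independent_integral_indic// big_nil mul1r.
pose W x := \prod_(i <- s) f i (X i x) * \prod_(i <- s2) \1_(B i) (X i x).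
have mW : measurable_fun setT W.
  apply: measurable_funM; apply: measurable_prod => j _ //.
  apply: (measurableT_comp (measurable_indic _)) => //.
have W0 x : 0 <= W x.
  by rewrite mulr_ge0//; apply: prodr_ge0 => j _ //; rewrite indicE.
pose c := \prod_(i <- s) e i * \prod_(i <- s2) pr i (B i).
have c0 : 0 <= c by rewrite mulr_ge0//; apply: prodr_ge0 => j _ //; rewrite fine_ge0.
have mX : measurable_fun setT (X i) by exact: measurable_funPT.
have h1 := ge0_functional_comp mX mW W0 (ge0_functional_integral P).
have h2 := ge0_functional_comp mX (@measurable_cst _ _ O _ setT c) (fun=> c0)
  (ge0_functional_integral P).
have /andP[iN us'] : (i \notin s ++ s2) && uniq (s ++ s2) by [].
suff /(ge0_functional_eq h1 h2) HB : forall B', measurable B' ->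
    (\int[P]_x ((W x)%:E * (\1_B' (X i x))%:E) = \int[P]_x (c%:E * (\1_B' (X i x))%:E))%E.
  transitivity (\int[P]_x ((W x)%:E * (f i (X i x))%:E))%E.
    by apply: eq_integral => x _; rewrite -EFinM big_cons /W; congr EFin; ring.
  rewrite (HB (EFin \o f i)); last 2 first.
  - exact/measurable_EFinP.
  - by move=> x; rewrite lee_fin.
  rewrite /= (@ge0_integralZl _ _ _ P _ _ (fun x => (f i (X i x))%:E))//; last 2 first.
  - exact/measurable_EFinP.
  - by move=> x _; rewrite lee_fin.
  by rewrite /= fe -EFinM big_cons /c; congr EFin; ring.
move=> B' mB'.
pose B2 j := if j == i then B' else B j.
have B2E j : j \in s2 -> B2 j = B j.
  move=> js; rewrite /B2; case: eqP => // ji; move: iN.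
  by rewrite mem_cat -ji js orbT.
have B2i : B2 i = B' by rewrite /B2 eqxx.
have mB2 j : measurable (B2 j) by rewrite /B2; case: ifP.
have us3 : uniq (s ++ i :: s2) by rewrite -cat1s uniq_catCA /= iN.
have := IH us (i :: s2) B2 us3 mB2.
rewrite !big_cons B2i.
transitivity (\int[P]_x (\prod_(j <- s) f j (X j x) *
    \prod_(j <- (i :: s2)) \1_(B2 j) (X j x))%:E)%E.
  apply: eq_integral => x _; rewrite -EFinM big_cons B2i /W; congr EFin.
  have -> : \prod_(j <- s2) \1_(B2 j) (X j x) = \prod_(j <- s2) \1_(B j) (X j x) :> R.
    by rewrite big_seq [RHS]big_seq; apply: eq_bigr => j /B2E ->.
  by rewrite mulrAC mulrA.
rewrite IH//.
rewrite ge0_integralZl//; last first.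
  exact/measurable_EFinP/(measurableT_comp (measurable_indic _)).
have -> : (\int[P]_x (\1_B' (X i x))%:E = (pr i B')%:E)%E.
  have := @independent_integral_indic [:: i] (fun=> B') isT (fun=> mB').
  by under eq_integral do rewrite big_seq1; rewrite big_seq1.
rewrite -EFinM big_cons B2i /c; congr EFin.
have -> : \prod_(j <- s2) pr j (B2 j) = \prod_(j <- s2) pr j (B j).
  by rewrite big_seq [RHS]big_seq; apply: eq_bigr => j /B2E ->.
ring.
Qed.

End independence.

(** * Histories of tree growth *)

Section histories.
Variable m : nat.
Implicit Types (l : seq (seq 'I_m)) (u v w : seq 'I_m) (i : 'I_m).
Local Open Scope nat_scope.

Definition external l : seq (seq 'I_m) :=
  [seq w <- [seq rcons u i | u <- l, i <- enum 'I_m] | w \notin l].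

Fixpoint histories n : seq (seq (seq 'I_m)) :=
  if n is k.+1 then [seq rcons l v | l <- histories k, v <- external l]
  else [:: [:: [::]]].

Definition rooted_tree l := [/\ uniq l, [::] \in l & forall u i, rcons u i \in l -> u \in l].

Lemma mem_external l u i : (rcons u i \in external l) = (u \in l) && (rcons u i \notin l).
Proof.
rewrite mem_filter andbC; congr (_ && _).
apply/allpairsP/idP => [[[u' i'] /= [u'l _ /rcons_inj[-> _]]] //|ul].
by exists (u, i); rewrite mem_enum.
Qed.

Lemma externalP l w :
  reflect (exists u i, [/\ w = rcons u i, u \in l & w \notin l]) (w \in external l).
Proof.
apply: (iffP idP) => [|[u [i [-> ul wl]]]]; last by rewrite mem_external ul.
rewrite mem_filter => /andP[wl /allpairsP[[u i] /= [ul _ we]]].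
by exists u, i.
Qed.

Lemma uniq_children l : uniq l -> uniq [seq rcons u i | u <- l, i <- enum 'I_m].
Proof.
move=> ul; apply: allpairs_uniq => //; first exact: enum_uniq.
by move=> [u i] [v j] _ _ /= /rcons_inj[-> ->].
Qed.

Lemma size_external l : rooted_tree l -> 0 < m -> size (external l) = (size l * m.-1).+1.
Proof.
move=> [ul rl pl] m0.
have e : perm_eq [seq w <- [seq rcons u i | u <- l, i <- enum 'I_m] | w \in l]
                 [seq w <- l | w != [::]].
  apply: uniq_perm; rewrite ?filter_uniq ?uniq_children//.
  move=> w; rewrite !mem_filter andbC [RHS]andbC.
  have [wl|] := boolP (w \in l); last by rewrite andbF.
  rewrite andbT; case/lastP: w wl => [|w i] wl.
    by apply/negP => /allpairsP[[u i] /= [_ _]] => /(congr1 size); rewrite size_rcons.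
  rewrite -size_eq0 size_rcons; apply/allpairsP; exists (w, i); split => //=.
  - exact: pl wl.
  - by rewrite mem_enum.
have := perm_size e; rewrite !size_filter => e1.
have arith (a x s : nat) : a + x = s * m -> 1 + a = s -> x = (s * m.-1).+1.
  by have := prednK m0; nia.
apply: arith; last first.
  by rewrite -(count_predC (pred1 [::]) l) count_uniq_mem// rl.
have := size_allpairs rcons l (enum (ordinal m)); rewrite size_enum_ord -e1 => <-.
exact: (count_predC (mem l)).
Qed.

Lemma rooted_tree_rcons l v : rooted_tree l -> v \in external l -> rooted_tree (rcons l v).
Proof.
move=> [ul rl pl] /externalP[u [i [ve ul' vl]]]; split.
- by rewrite rcons_uniq vl.
- by rewrite mem_rcons inE rl orbT.
- move=> w j; rewrite !mem_rcons !inE => /orP[/eqP|/pl ->]; last by rewrite orbT.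
  by rewrite ve => /rcons_inj[-> _]; rewrite ul' orbT.
Qed.

Lemma historiesSP n l :
  reflect (exists2 l', l' \in histories n & exists2 v, v \in external l' & l = rcons l' v)
  (l \in histories n.+1).
Proof.
apply: (iffP idP) => [/allpairsPdep[l' [v [h1 h2 h3]]]|[l' h1 [v h2 h3]]].
  by exists l' => //; exists v.
by apply/allpairsPdep; exists l', v.
Qed.

Lemma histories_rooted n l : l \in histories n -> rooted_tree l.
Proof.
elim: n l => [|n IH] l.
  rewrite inE => /eqP ->; split => // u i; rewrite inE => /eqP /(congr1 size).
  by rewrite size_rcons.
by move=> /historiesSP[l' /IH h [v hv ->]]; exact: rooted_tree_rcons.
Qed.

Lemma histories_size n l : l \in histories n -> size l = n.+1.
Proof.
elim: n l => [|n IH] l; first by rewrite inE => /eqP ->.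
by move=> /historiesSP[l' /IH h [v hv ->]]; rewrite size_rcons h.
Qed.

Lemma size_histories n : 0 < m -> size (histories n) = \prod_(k < n) (k.+1 * m.-1).+1.
Proof.
move=> m0; elim: n => [|n IH]; first by rewrite big_ord0.
rewrite big_ord_recr /= size_allpairs_dep -IH.
rewrite (_ : [seq _ | _ <- _] = nseq (size (histories n)) (n.+1 * m.-1).+1).
  by rewrite sumn_nseq mulnC.
rewrite -(size_map (fun l => size (external l)) (histories n)).
apply/all_pred1P/allP => _ /mapP[l lh ->] /=.
by rewrite size_external ?(histories_size lh)//; exact: histories_rooted lh.
Qed.

Lemma uniq_histories n : uniq (histories n).
Proof.
elim: n => [//|n IH] /=; apply: allpairs_uniq_dep => //.
  move=> l /histories_rooted[ul _ _]; apply: filter_uniq; exact: uniq_children.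
by move=> [l v] [l' v'] _ _ /= /rcons_inj[-> ->].
Qed.

Lemma external_history n l k : l \in histories n -> k < n ->
  nth [::] l k.+1 \in external (take k.+1 l).
Proof.
elim: n l => [//|n IH] l /historiesSP[l' h [v hv ->]]; rewrite ltnS leq_eqVlt.
have sl' := histories_size h.
move=> /orP[/eqP ->|kn].
  by rewrite nth_rcons sl' ltnn eqxx -cats1 take_size_cat.
rewrite nth_rcons sl' ltnS kn -cats1 takel_cat; last by rewrite sl' ltnS ltnW.
exact: IH.
Qed.

Lemma history_nth0 n l : l \in histories n -> nth [::] l 0 = [::].
Proof.
elim: n l => [|n IH] l; first by rewrite inE => /eqP ->.
by move=> /historiesSP[l' h [v hv ->]]; rewrite nth_rcons (histories_size h) /= (IH _ h).
Qed.

Definition history_tree l n : tree m := [fset v in take n.+1 l]%fset.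

Lemma history_tree_inj n l l' : l \in histories n -> l' \in histories n ->
  (forall k, k <= n -> history_tree l k = history_tree l' k) -> l = l'.
Proof.
move=> hl hl' h; apply: (@eq_from_nth _ [::]); rewrite ?(histories_size hl) ?(histories_size hl')//.
suff H k : k <= n -> take k.+1 l = take k.+1 l'.
  move=> i; rewrite ltnS => /H e.
  by rewrite -(nth_take _ (ltnSn i)) e nth_take.
elim: k => [_|k IH kn].
  rewrite !(take_nth [::]) ?(histories_size hl) ?(histories_size hl')// !take0.
  by rewrite (history_nth0 hl) (history_nth0 hl').
have := h _ kn; rewrite /history_tree.
rewrite !(take_nth [::] (n := k.+1)) ?(histories_size hl) ?(histories_size hl')//.
rewrite (IH (ltnW kn)) => /fsetP /(_ (nth [::] l k.+1)).
rewrite !inE !mem_rcons !inE eqxx /=.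
have /externalP[_ [_ [_ _]]] := external_history hl kn.
by rewrite (IH (ltnW kn)) => /negbTE -> ; rewrite orbF => /esym/eqP ->.
Qed.

End histories.

(** * Laws of discrete sequences *)

Section discrete_laws.
Context {R : realType}.

Lemma same_law_countable (S : countType)
    d1 (O1 : measurableType d1) (P1 : probability O1 R) (U1 : O1 -> S)
    d2 (O2 : measurableType d2) (P2 : probability O2 R) (U2 : O2 -> S) :
  discrete_rv U1 -> discrete_rv U2 ->
  (forall s, P1 (U1 @^-1` [set s]) = P2 (U2 @^-1` [set s])) ->
  forall B, P1 (U1 @^-1` B) = P2 (U2 @^-1` B).
Proof.
move=> mU1 mU2 h B.
have split d (O : measurableType d) (P : probability O R) (U : O -> S) : discrete_rv U ->
    P (U @^-1` B) = (\sum_(k <oo) P (U @^-1` (B `&` (fun t => choice.pickle t = k))))%E.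
  move=> mU.
  have -> : U @^-1` B = \bigcup_k (U @^-1` (B `&` (fun t => choice.pickle t = k))).
    apply/seteqP; split => [x Bx|x [k _ [Bx _]] //].
    by exists (choice.pickle (U x)).
  rewrite measure_bigcup//; last first.
  - apply/trivIsetP => i j _ _ ij; apply/seteqP; split => // x [[_ xi] [_ xj]].
    by move: ij; rewrite -xi -xj eqxx.
  - by apply: eq_eseriesl => k; exact: mem_set.
rewrite !split//; apply: eq_eseriesr => k _.
have [[s [Bs sk]]|hn] := pselect (exists s, B s /\ choice.pickle s = k).
  have -> : B `&` (fun t => choice.pickle t = k) = [set s].
    apply/seteqP; split => [t [Bt tk]|t ->] //=.
    by apply: (pcan_inj (@choice.pickleK _)); rewrite sk.
  exact: h.
have -> : B `&` (fun t => choice.pickle t = k) = set0.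
  by apply/seteqP; split => // s [Bs sk]; apply: hn; exists s.
by rewrite !preimage_set0 !measure0.
Qed.

Lemma discrete_rv_bind d (O : measurableType d) (S : countType) (T : Type)
    (f : O -> S) (g : S -> O -> T) :
  discrete_rv f -> (forall a, discrete_rv (g a)) -> discrete_rv (fun x => g (f x) x).
Proof.
move=> mf mg B.
have -> : (fun x => g (f x) x) @^-1` B = \bigcup_(a : S) (f @^-1` [set a] `&` g a @^-1` B).
  apply/seteqP; split => [x Bx|x [a _ [/= <-]]] //.
  by exists (f x).
apply: countable_bigcupT_measurable; first exact: countableP.
by move=> a; apply: measurableI; [exact: mf|exact: mg].
Qed.

Lemma discrete_rv_cst d (O : measurableType d) (T : Type) (a : T) : discrete_rv (fun _ : O => a).
Proof.
move=> B; have [Ba|Ba] := pselect (B a).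
  by rewrite (_ : _ @^-1` _ = setT)//; apply/seteqP; split.
by rewrite (_ : _ @^-1` _ = set0)//; apply/seteqP; split.
Qed.

Lemma discrete_rv_mkseq (S : countType) d (O : measurableType d) (X : O -> nat -> S) n :
  (forall k, discrete_rv (fun x => X x k)) -> discrete_rv (fun x => mkseq (X x) n).
Proof.
move=> mX B.
have -> : (fun x => mkseq (X x) n) @^-1` B =
    \bigcup_(s in B) ((fun x => mkseq (X x) n) @^-1` [set s]).
  apply/seteqP; split => [x Bx|x [s Bs xs]]; first by exists (mkseq (X x) n).
  by move: xs => /= xs; rewrite /preimage/= xs.
rewrite bigcup_mkcond; apply: countable_bigcupT_measurable; first exact: countableP.
move=> s; case: ifP => // _.
have [sn|sn] := eqVneq (size s) n; last first.
  rewrite (_ : _ @^-1` _ = set0)//; apply/seteqP; split => // x /= xs.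
  by move: sn; rewrite -xs size_mkseq eqxx.
case: s sn => [|s0 s'] sn.
  by rewrite (_ : _ @^-1` _ = setT)//; apply/seteqP; split => // x _ /=; rewrite -sn.
set s := s0 :: s' in sn *.
have -> : (fun x => mkseq (X x) n) @^-1` [set s] =
    \bigcap_(k in `I_n) ((fun x => X x k) @^-1` [set nth s0 s k]).
  apply/seteqP; split => [x /= xs k kn|x /= xs] /=; first by rewrite -xs nth_mkseq.
  apply: (@eq_from_nth _ s0); rewrite size_mkseq// => k kn.
  by rewrite nth_mkseq//; exact: xs.
by apply: fin_bigcap_measurable => // k _; exact: mX.
Qed.

Lemma take_mkseq (T : Type) (x : nat -> T) n k : (k <= n)%N -> take k (mkseq x n) = mkseq x k.
Proof. by move=> kn; rewrite -map_take take_iota; move/minn_idPl: kn => ->. Qed.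

Definition agree_upto (T : Type) (n : nat) (s t : nat -> T) := forall k, (k <= n)%N -> s k = t k.

Lemma measurable_agree_upto d (O : measurableType d) (S : countType) (Y : O -> nat -> S) n t :
  (forall k, discrete_rv (Y ^~ k)) -> measurable [set x | agree_upto n (Y x) t].
Proof.
move=> mY; have -> : [set x | agree_upto n (Y x) t] =
    \bigcap_(k in `I_n.+1) ((Y ^~ k) @^-1` [set t k]).
  by apply/seteqP; split => x hx k; exact: hx.
by apply: fin_bigcap_measurable => // k _; exact: mY.
Qed.

Lemma same_law_prefix (S : countType)
    d1 (O1 : measurableType d1) (P1 : probability O1 R) (X1 : O1 -> nat -> S)
    d2 (O2 : measurableType d2) (P2 : probability O2 R) (X2 : O2 -> nat -> S) :
  (forall k, discrete_rv (fun x => X1 x k)) ->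
  (forall k, discrete_rv (fun x => X2 x k)) ->
  (forall n t, P1 [set x | agree_upto n (X1 x) t] = P2 [set x | agree_upto n (X2 x) t]) ->
  same_law P1 X1 P2 X2.
Proof.
move=> mX1 mX2 h.
pose G := [set A : set (nat -> S) | exists n (B : set (seq S)), A = [set x | B (mkseq x n.+1)]].
pose D := [set A : set (nat -> S) | [/\ measurable (X1 @^-1` A), measurable (X2 @^-1` A) &
   P1 (X1 @^-1` A) = P2 (X2 @^-1` A)]].
have GI : setI_closed G.
  move=> A A' [n [B ->]] [n' [B' ->]].
  exists (maxn n n'), [set s : seq S | B (take n.+1 s) /\ B' (take n'.+1 s)].
  have e1 x : take n.+1 (mkseq x (maxn n n').+1) = mkseq x n.+1.
    by rewrite take_mkseq// ltnS leq_maxl.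
  have e2 x : take n'.+1 (mkseq x (maxn n n').+1) = mkseq x n'.+1.
    by rewrite take_mkseq// ltnS leq_maxr.
  apply/seteqP; split => x; last by move=> -[]; rewrite e1 e2.
  by move=> [h1 h2]; split; [rewrite e1|rewrite e2].
have GD : G `<=` D.
  move=> A [n [B ->]]; split.
  - exact: (discrete_rv_mkseq n.+1 mX1).
  - exact: (discrete_rv_mkseq n.+1 mX2).
  apply: (same_law_countable (discrete_rv_mkseq n.+1 mX1) (discrete_rv_mkseq n.+1 mX2)) => s.
  have [sn|sn] := eqVneq (size s) n.+1; last first.
    have e d (O : measurableType d) (X : O -> nat -> S) :
        (fun x => mkseq (X x) n.+1) @^-1` [set s] = set0.
      by apply/seteqP; split => // x /= xs; move: sn; rewrite -xs size_mkseq eqxx.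
    by rewrite !e !measure0.
  case: s sn => [//|s0 s'] sn; set s := s0 :: s' in sn *.
  have e d (O : measurableType d) (X : O -> nat -> S) : (fun x => mkseq (X x) n.+1) @^-1` [set s] =
     [set x | agree_upto n (X x) (nth s0 s)].
    apply/seteqP; split => x /= xs.
      by move=> k kn; rewrite -xs nth_mkseq.
    apply: (@eq_from_nth _ s0); rewrite size_mkseq// => k kn.
    by rewrite nth_mkseq//; exact: xs.
  by rewrite !e.
have dD : dynkin D.
  split.
  - split; rewrite ?preimage_setT; [exact: measurableT|exact: measurableT|].
    exact: (etrans (probability_setT P1) (esym (probability_setT P2))).
  - move=> A [m1 m2 e]; split; rewrite preimage_setC; [exact: measurableC|exact: measurableC|].
    by rewrite (probability_setC P1 m1) (probability_setC P2 m2) e.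
  - move=> F tF FD; split; rewrite ?preimage_bigcup.
    + by apply: bigcupT_measurable => k; have [] := FD k.
    + by apply: bigcupT_measurable => k; have [] := FD k.
    rewrite !measure_bigcup//.
    + by apply: eq_eseriesr => k _; have [] := FD k.
    + by move=> k _; have [] := FD k.
    + apply/trivIsetP => a b _ _ ab.
      by rewrite -preimage_setI ((iffLR trivIsetP tF) _ _ I I ab)// preimage_set0.
    + by move=> k _; have [] := FD k.
    + apply/trivIsetP => a b _ _ ab.
      by rewrite -preimage_setI ((iffLR trivIsetP tF) _ _ I I ab)// preimage_set0.
have sD : <<s G >> `<=` D.
  by rewrite -(setI_closed_g_dynkin_g_sigma_algebra GI); apply: smallest_sub.
move=> A cA; suff : D A by case.
apply: sD; apply: cA; split.
  exact: smallest_sigma_algebra.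
move=> _ [n [B ->]]; apply: sub_sigma_algebra.
exists n, [set s : seq S | exists2 x, B (x n) & s = mkseq x n.+1].
apply/seteqP; split => x /=; first by exists x.
move=> [y By e]; suff -> : x n = y n by [].
by rewrite -(@nth_mkseq _ (x n) x n.+1 n)// e nth_mkseq.
Qed.

Lemma measure_bigsetU_seq d (O : measurableType d) (P : {measure set O -> \bar R}) (J : eqType)
    (s : seq J) (E : J -> set O) :
  uniq s -> (forall j, measurable (E j)) ->
  (forall i j, i \in s -> j \in s -> E i `&` E j !=set0 -> i = j) ->
  P (\big[setU/set0]_(j <- s) E j) = (\sum_(j <- s) P (E j))%E.
Proof.
move=> us mE; elim: s us => [_ _|j s IH /= /andP[js us] dE].
  by rewrite !big_nil measure0.
rewrite !big_cons -IH//; last by move=> i k si sk; apply: dE; rewrite inE ?si ?sk orbT.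
apply: measureU => //.
- by apply: bigsetU_measurable => i _.
- rewrite big_distrr big_seq big1// => i si.
  apply/eqP/negPn/negP => /set0P h; move: js.
  by rewrite (dE j i) ?inE ?eqxx ?si ?orbT.
Qed.

Lemma uniform_atoms d (O : measurableType d) (P : probability O R) (J : eqType) (s : seq J)
    (E : J -> set O) :
  uniq s -> (0 < size s)%N -> (forall j, measurable (E j)) ->
  (forall i j, i \in s -> j \in s -> E i `&` E j !=set0 -> i = j) ->
  (forall j, j \in s -> (((size s)%:R^-1)%:E <= P (E j))%E) ->
  (forall j, j \in s -> P (E j) = ((size s)%:R^-1)%:E) /\
  (forall A, measurable A -> (forall j, j \in s -> E j `&` A = set0) -> P A = 0%E).
Proof.
move=> us s0 mE dE hE.
set c := (size s)%:R^-1 in hE *; pose p j := fine (P (E j)).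
have pE j : P (E j) = (p j)%:E by rewrite /p fineK// fin_num_measure.
set U := \big[setU/set0]_(j <- s) E j.
have mU : measurable U by apply: bigsetU_measurable => i _.
have PU : P U = (\sum_(j <- s) p j)%:E.
  by rewrite measure_bigsetU_seq// -sumEFin; apply: eq_bigr => j _; exact: pE.
have sum_c : \sum_(j <- s) c = 1.
  by rewrite big_const_seq count_predT iter_addr addr0 -mulr_natl divff// pnatr_eq0 -lt0n.
have cp j : j \in s -> c <= p j by move=> /hE; rewrite pE lee_fin.
have sum_p : \sum_(j <- s) p j = 1.
  apply/eqP; rewrite eq_le -lee_fin -PU probability_le1//=.
  by rewrite -sum_c [leLHS]big_seq [leRHS]big_seq; apply: ler_sum => j /cp.
split=> [j js|A mA dA].
  rewrite pE; congr EFin; apply/eqP; rewrite eq_le cp// andbT.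
  have : \sum_(i <- s) p i - \sum_(i <- s) c = 0 by rewrite sum_p sum_c subrr.
  rewrite -sumrB (big_rem j)//= => /eqP; rewrite addr_eq0 => /eqP e.
  rewrite -subr_le0 e oppr_le0 big_seq; apply: sumr_ge0 => i /mem_rem si.
  by rewrite subr_ge0 cp.
have : (P (U `|` A) <= 1)%E by apply: probability_le1; exact: measurableU.
have -> : P (U `|` A) = (P U + P A)%E.
  apply: measureU => //.
  by rewrite setIC big_distrr big_seq big1// => j js; rewrite [LHS]setIC; exact: dA.
rewrite PU sum_p -[P A]fineK ?fin_num_measure// -EFinD lee_fin gerDl => h.
by congr EFin; apply/eqP; rewrite eq_le h fine_ge0.
Qed.

End discrete_laws.

(** * Preferential attachment with random labels *)

Section labelling_count.
Variables (m n : nat) (h : nat -> nat) (i : nat -> 'I_m).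
Hypothesis h_le : forall k, (k < n)%N -> (h k <= k)%N.
Hypothesis i_inj : forall j k, (j < k)%N -> (k < n)%N -> h j = h k -> i j != i k.
Local Open Scope nat_scope.

Let d k := outdegree h k (h k).
Let used k := [seq i j | j <- iota 0 k & h j == h k].

Lemma outdegreeS k v : outdegree h k.+1 v = outdegree h k v + (h k == v).
Proof. by rewrite /outdegree -addn1 iotaD count_cat /= addn0 add0n. Qed.

Lemma outdegree_lt j k : j < k -> h j = h k -> d j < d k.
Proof.
move=> jk hjk; rewrite /d hjk; have : outdegree h j.+1 (h k) <= outdegree h k (h k).
  by rewrite /outdegree -(subnKC jk) iotaD count_cat leq_addr.
by rewrite outdegreeS hjk eqxx addn1.
Qed.

Lemma size_used k : size (used k) = d k.
Proof. by rewrite size_map size_filter. Qed.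

Lemma uniq_used k : k < n -> uniq (used k).
Proof.
move=> kn; rewrite map_inj_in_uniq ?filter_uniq ?iota_uniq//.
move=> j j'; rewrite !mem_filter !mem_iota /= !add0n => /andP[/eqP hj jk] /andP[/eqP hj' j'k] e.
have [jj'|jj'|//] := ltngtP j j'.
  by have := i_inj jj' (ltn_trans j'k kn); rewrite hj hj' e eqxx => /(_ erefl).
by have := i_inj jj' (ltn_trans jk kn); rewrite hj hj' e eqxx => /(_ erefl).
Qed.

Lemma used_notin k : k < n -> i k \notin used k.
Proof.
move=> kn; apply/mapP => -[j]; rewrite mem_filter mem_iota add0n /= => /andP[/eqP hj jk] e.
by have := i_inj jk kn hj; rewrite e eqxx.
Qed.

Lemma outdegree_ltm k : k < n -> d k < m.
Proof.
move=> kn; rewrite -size_used -[X in _ < X]card_ord.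
have := uniq_leq_size (s1 := i k :: used k) (s2 := enum 'I_m).
rewrite /= used_notin ?uniq_used// size_enum_ord card_ord; apply => // j _.
by rewrite mem_enum.
Qed.

Let slot k : 'I_m := insubd (i k) (d k).

Lemma val_slot k : k < n -> slot k = d k :> nat.
Proof. by move=> kn; rewrite /slot val_insubd outdegree_ltm. Qed.

Definition label_constraint (t : {ffun 'I_n.+1 -> {perm 'I_m}}) k :=
  t (inord (h k)) (slot k) == i k.

Definition compatible_labellings k :=
  [set t | [forall j : 'I_n, (j < k) ==> label_constraint t j]]%SET.

Lemma compatibleP k t : k <= n ->
  reflect (forall j, j < k -> label_constraint t j) (t \in compatible_labellings k).
Proof.
move=> kn; rewrite inE; apply: (iffP forallP) => [H j jk|H j].
  by have := H (Ordinal (leq_trans jk kn)); rewrite jk.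
by apply/implyP; exact: H.
Qed.

Let fib k c := [set t in compatible_labellings k | t (inord (h k)) (slot k) == c]%SET.

Let relabel k c c' (t : {ffun 'I_n.+1 -> {perm 'I_m}}) : {ffun 'I_n.+1 -> {perm 'I_m}} :=
  [ffun v => if v == inord (h k) then (t v * tperm c c')%g else t v].

Lemma relabelK k c c' : involutive (relabel k c c').
Proof.
move=> t; apply/ffunP => v; rewrite !ffunE; case: (v == _) => //.
by rewrite -mulgA tperm2 mulg1.
Qed.

(* Composing the permutation of the new parent with a transposition of two unused
   labels exchanges the labellings giving these labels to the new child. *)
Lemma card_fib_le k c c' : k < n -> c \notin used k -> c' \notin used k ->
  #|fib k c| <= #|fib k c'|.
Proof.
move=> kn cu cu'; rewrite -(card_imset _ (can_inj (relabelK k c c'))).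
apply/subset_leq_card/fintype.subsetP => _ /imsetP[t tA ->].
move: tA; rewrite finset.in_set => /andP[/(compatibleP _ (ltnW kn)) tQ /eqP tc]; rewrite finset.in_set.
apply/andP; split; last by rewrite !ffunE eqxx permM tc tpermL.
apply/(compatibleP _ (ltnW kn)) => j jk; have := tQ j jk; rewrite /label_constraint ffunE.
case: ifPn => // /eqP hjk /eqP tj; rewrite permM tj tpermD//.
  apply: contraNneq cu => ->; apply: map_f; rewrite mem_filter mem_iota add0n jk leq0n !andbT.
  have := congr1 val hjk; rewrite /= !inordK ?ltnS; first by move=> ->.
  - exact: leq_trans (h_le kn) (ltnW kn).
  - exact: leq_trans (h_le (ltn_trans jk kn)) (ltnW (ltn_trans jk kn)).
apply: contraNneq cu' => ->; apply: map_f; rewrite mem_filter mem_iota add0n jk leq0n !andbT.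
have := congr1 val hjk; rewrite /= !inordK ?ltnS; first by move=> ->.
- exact: leq_trans (h_le kn) (ltnW kn).
- exact: leq_trans (h_le (ltn_trans jk kn)) (ltnW (ltn_trans jk kn)).
Qed.

Lemma card_compatibleS k : k < n ->
  #|compatible_labellings k| = (m - d k) * #|compatible_labellings k.+1|.
Proof.
move=> kn.
have fibS : compatible_labellings k.+1 = fib k (i k).
  apply/setP => t; rewrite [in RHS]inE; apply/(compatibleP _ kn)/andP => [H|[/(compatibleP _ (ltnW kn)) H H'] j].
    split; last exact: H.
    by apply/(compatibleP _ (ltnW kn)) => j jk; apply: H; exact: ltnW.
  by rewrite ltnS leq_eqVlt => /orP[/eqP ->|/H].
have -> : #|compatible_labellings k| = \sum_(c : 'I_m) #|fib k c|.
  rewrite -sum1_card (partition_big (fun t : {ffun 'I_n.+1 -> {perm 'I_m}} => t (inord (h k)) (slot k)) predT)//=.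
  by apply: eq_bigr => c _; rewrite -sum1_card; apply: eq_bigl => t; rewrite [RHS]finset.in_set.
rewrite (bigID (mem (used k)))/= big1 ?add0n; last first.
  move=> c /mapP[j]; rewrite mem_filter mem_iota add0n /= => /andP[/eqP hj jk] ->.
  apply/eqP; rewrite cards_eq0; apply/eqP/setP => t; rewrite [in RHS]inE.
  apply/negP; rewrite inE => /andP[/(compatibleP _ (ltnW kn)) /(_ _ jk) /eqP tj /eqP].
  rewrite -tj hj => /perm_inj /(congr1 val) /=; rewrite !val_slot//; last exact: ltn_trans jk kn.
  by move=> e; have := outdegree_lt jk hj; rewrite e ltnn.
rewrite (eq_bigr (fun=> #|fib k (i k)|)); last first.
  by move=> c cu; apply/eqP; rewrite eqn_leq !card_fib_le// used_notin.
rewrite sum_nat_const fibS; congr (_ * _).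
rewrite -size_used -(card_uniqP (uniq_used kn)) -[X in _ = X - _]card_ord -(cardC (mem (used k))).
by rewrite addKn; apply: eq_card => c; rewrite !inE.
Qed.

Lemma card_compatible k : k <= n ->
  #|compatible_labellings k| * \prod_(j < k) (m - d j) = m`! ^ n.+1.
Proof.
elim: k => [_|k IH kn].
  rewrite big_ord0 muln1 (_ : compatible_labellings 0 = [set: _]%SET); last first.
    by apply/setP => t; rewrite !inE; apply/forallP.
  by rewrite cardsT card_ffun card_ord card_Sn.
by rewrite -(IH (ltnW kn)) (card_compatibleS kn) big_ord_recr /=; nia.
Qed.

End labelling_count.

Section preferential_attachment_probabilities.
Context {R : realType} d (O : measurableType d) (P : probability O R).
Variables (m : nat) (par : nat -> O -> nat) (s : nat -> O -> {perm 'I_m}).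
Hypothesis m0 : (0 < m)%N.
Hypothesis hpar : preferential_attachment P (fun k => m%:R - k%:R) par.
Hypothesis hs : uniform_labelling P par s.

Lemma sum_outdegree h k : (forall j, (j < k)%N -> (h j <= j)%N) ->
  (\sum_(u < k.+1) outdegree h k u = k)%N.
Proof.
move=> hle; rewrite /outdegree.
under eq_bigr do rewrite -sum1_count big_mkcond /=.
rewrite exchange_big /= big_seq (eq_bigr (fun=> 1%N)) => [|j].
  by rewrite -big_seq sum1_size size_iota.
rewrite mem_iota add0n /= => jk.
have hj : (h j < k.+1)%N by rewrite ltnS (leq_trans (hle _ jk))// ltnW.
rewrite (bigD1 (Ordinal hj))//= eqxx big1 ?addn0// => u /eqP uj.
by case: eqP => // e; case: uj; apply: val_inj.
Qed.

Lemma past_probability n h : (forall k, (k < n)%N -> (h k <= k)%N) ->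
  P (past par h n) =
    (\prod_(k < n) ((m%:R - (outdegree h k (h k))%:R) / (k.+1 * m.-1).+1%:R))%:E.
Proof.
elim: n => [_|n IH hle].
  rewrite big_ord0 (_ : past par h 0 = setT); first exact: probability_setT.
  by apply/seteqP; split.
have hle' k : (k < n)%N -> (h k <= k)%N by move=> kn; apply: hle; exact: ltnW.
have hn : (h n < n.+1)%N by rewrite ltnS hle.
have -> : past par h n.+1 = past par h n `&` [set x | par n x = Ordinal hn].
  apply/seteqP; split => [x /= hx|x [hx hxn] k] /=; last first.
    by rewrite ltnS leq_eqVlt => /orP[/eqP ->//|/hx].
  by split; [move=> k kn; apply: hx; exact: ltnW|exact: hx].
rewrite hpar.2 IH// [in RHS]big_ord_recr -EFinM /=; congr EFin; congr (_ * (_ / _)).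
rewrite sumrB sumr_const card_ord -natr_sum sum_outdegree//.
rewrite -mulrnA -natrB; first by congr (_%:R); case: (m) m0 => // ? _ /=; nia.
by rewrite mulnC (leq_trans (leqnSn n))// leq_pmulr.
Qed.

Definition labels_upto n (t : nat -> {perm 'I_m}) : set O :=
  [set x | forall v, (v < n)%N -> s v x = t v].

Lemma measurable_past h n : measurable (past par h n).
Proof.
have -> : past par h n = \bigcap_(k in `I_n) (par k @^-1` [set h k]).
  by apply/seteqP; split => x hx k; exact: hx.
by apply: fin_bigcap_measurable => // k _; exact: hpar.1.
Qed.

Lemma measurable_labels_upto n t : measurable (labels_upto n t).
Proof.
have -> : labels_upto n t = \bigcap_(k in `I_n) (s k @^-1` [set t k]).
  by apply/seteqP; split => x hx k; exact: hx.
by apply: fin_bigcap_measurable => // k _; exact: hs.1.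
Qed.

Lemma labelled_past_probability n h (i : nat -> 'I_m) : (forall k, (k < n)%N -> (h k <= k)%N) ->
  (forall j k, (j < k)%N -> (k < n)%N -> h j = h k -> i j != i k) ->
  P (\big[setU/set0]_(t <- enum (compatible_labellings n h i n))
       (past par h n `&` labels_upto n.+1 (fun v => t (inord v)))) =
  ((\prod_(k < n) (k.+1 * m.-1).+1)%N%:R^-1)%:E.
Proof.
move=> hle iinj; rewrite measure_bigsetU_seq; last 3 first.
- exact: enum_uniq.
- by move=> t; apply: measurableI; [exact: measurable_past|exact: measurable_labels_upto].
- move=> t t' _ _ [x [[_ h1] [_ h2]]]; apply/ffunP => v.
  by have := h1 v (ltn_ord v); rewrite h2 ?ltn_ord// inord_val.
rewrite (eq_bigr (fun=> P (past par h n) * ((m`!%:R)^-1 ^+ n.+1)%:E)%E); last by move=> t _; exact: hs.2.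
rewrite past_probability// -EFinM.
rewrite sumEFin big_const_seq count_predT iter_addr addr0 -cardE; congr EFin.
have dm k : (k < n)%N -> (outdegree h k (h k) < m)%N by exact: outdegree_ltm iinj _.
rewrite -[LHS]mulr_natl big_split /=.
have -> : \prod_(k < n) (m%:R - (outdegree h k (h k))%:R : R) =
   (\prod_(k < n) (m - outdegree h k (h k)))%N%:R.
  rewrite natr_prod; apply: eq_bigr => k _; rewrite natrB//.
  by apply: ltnW; exact: dm.
have := card_compatible hle iinj (leqnn n).
set A := #|_|; set B := (\prod_(k < n) (m - outdegree h k (h k)))%N => AB.
rewrite prodfV [in RHS]natr_prod; set D := \prod_(k < n) (k.+1 * m.-1).+1%:R : R.
transitivity ((A * B)%:R * (m`!%:R^-1) ^+ n.+1 * D^-1); first by rewrite natrM; ring.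
by rewrite AB natrX exprVn divff ?mul1r// expf_neq0// pnatr_eq0 -lt0n fact_gt0.

Qed.
End preferential_attachment_probabilities.

Section history_positions.
Variables (m n : nat) (i0 : 'I_m) (l : seq (seq 'I_m)).
Hypothesis lh : l \in histories m n.
Local Open Scope nat_scope.

Definition history_parent k := 
  let w := nth [::] l k.+1 in index (take (size w).-1 w) l.

Definition history_label k := last i0 (nth [::] l k.+1).

Lemma history_parentP k : k < n ->
  history_parent k <= k /\
  nth [::] l k.+1 = rcons (nth [::] l (history_parent k)) (history_label k).
Proof.
move=> kn; rewrite /history_parent /history_label.
have /externalP[u [i [-> ul _]]] := external_history lh kn.
rewrite last_rcons size_rcons /= -cats1 take_size_cat// cats1.
have ul' : u \in l by exact: mem_take ul.
rewrite nth_index//; split => //.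
have e : index u l = index u (take k.+1 l) by rewrite -{1}(cat_take_drop k.+1 l) index_cat ul.
by rewrite e -ltnS; move: ul; rewrite -index_mem => /leq_trans; apply; rewrite size_take geq_minl.
Qed.

Lemma history_label_neq j k : j < k -> k < n -> history_parent j = history_parent k ->
  history_label j != history_label k.
Proof.
move=> jk kn e; apply/eqP => e'.
have [_ ej] := history_parentP (ltn_trans jk kn); have [_ ek] := history_parentP kn.
have [ul _ _] := histories_rooted lh.
have : nth [::] l j.+1 == nth [::] l k.+1 by rewrite ej ek e e'.
rewrite nth_uniq// ?(histories_size lh) ?ltnS//; last exact: ltn_trans jk kn.
by rewrite eqSS => /eqP jk'; move: jk; rewrite jk' ltnn.
Qed.

Lemma positions_history h (s : nat -> {perm 'I_m}) :
  (forall k, k < n -> h k = history_parent k) ->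
  (forall k (d : 'I_m), k < n -> d = outdegree h k (h k) :> nat -> s (h k) d = history_label k) ->
  forall k, k <= n -> positions h s k = take k.+1 l.
Proof.
move=> hh hs; have degm k : k < n -> outdegree h k (h k) < m.
  apply: (@outdegree_ltm m n h history_label) => j k' jk kn e.
  by apply: history_label_neq => //; rewrite -!hh// (ltn_trans jk).
elim=> [_|k IH kn] /=.
  by rewrite (take_nth [::]) ?(histories_size lh)// take0 (history_nth0 lh).
rewrite (IH (ltnW kn)) [RHS](take_nth [::]) ?(histories_size lh)//; congr rcons.
rewrite (insubT (fun d => d < m) (degm _ kn)) /= (hs k)//.
have [hk ->] := history_parentP kn.
by rewrite hh// nth_take// ltnS.
Qed.

End history_positions.

Section preferential_attachment_history.
Context {R : realType} d (O : measurableType d) (P : probability O R).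
Variables (m : nat) (par : nat -> O -> nat) (s : nat -> O -> {perm 'I_m}).
Hypothesis m0 : (0 < m)%N.
Hypothesis hpar : preferential_attachment P (fun k => m%:R - k%:R) par.
Hypothesis hs : uniform_labelling P par s.

Let X (x : O) n := labelled_tree (fun k => par k x) (fun v => s v x) n.+1.

Lemma outdegree_mkseq h k v : outdegree h k v = count (pred1 v) (mkseq h k).
Proof. by rewrite /outdegree /mkseq count_map. Qed.

Lemma discrete_rv_labelled_tree n : discrete_rv (X ^~ n).
Proof.
suff H : discrete_rv (fun x => positions (fun k => par k x) (fun v => s v x) n : seq (seq 'I_m)).
  pose F (a : seq (seq 'I_m)) : tree m := [fset v in a]%fset.
  have e : X ^~ n = (fun x => F (positions (fun k => par k x) (fun v => s v x) n)) by [].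
  by move=> B; rewrite e; exact: (H (F @^-1` B)).
elim: n => [|n IH] /=; first exact: discrete_rv_cst.
under eq_fun do rewrite outdegree_mkseq.
pose step (a : seq (seq 'I_m)) (p : nat) (hh : seq nat) (sp : {perm 'I_m}) : seq (seq 'I_m) :=
  rcons a (if omap sp (insub (count (pred1 p) hh)) is Some i then rcons (nth [::] a p) i else [::]).
apply: (discrete_rv_bind (g := fun a x => step a (par n x)
  (mkseq (fun k => par k x) n) (s (par n x) x)) IH) => a.
apply: (discrete_rv_bind (g := fun p x => step a p
  (mkseq (fun k => par k x) n) (s p x)) (hpar.1 n)) => p.
apply: (discrete_rv_bind (g := fun hh x => step a p hh (s p x))
  (discrete_rv_mkseq (X := fun x k => par k x) n hpar.1)) => hh.
by apply: (discrete_rv_bind (g := fun sp _ => step a p hh sp) (hs.1 p)) => sp; exact: discrete_rv_cst.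
Qed.

Lemma le_history_probability_labelled n l : l \in histories m n ->
  (((size (histories m n))%:R^-1)%:E <= P [set x | agree_upto n (X x) (history_tree l)])%E.
Proof.
move=> lh; pose i0 := Ordinal m0.
pose h := history_parent l; pose i := history_label i0 l.
have hle k : (k < n)%N -> (h k <= k)%N by move=> /(history_parentP i0 lh)[].
have iinj := history_label_neq i0 lh.
rewrite size_histories// -(labelled_past_probability m0 hpar hs hle iinj).
apply: le_measure; rewrite ?inE.
- apply: bigsetU_measurable => t _.
  by apply: measurableI; [exact: (measurable_past hpar)|exact: (measurable_labels_upto hs)].
- exact: measurable_agree_upto discrete_rv_labelled_tree.
rewrite -bigcup_seq => x [t /= + [px sx]] k kn; rewrite mem_enum => tC.
have tQ := elimT (@compatibleP m n h i n t (leqnn n)) tC.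
have posE : positions (fun k => par k x) (fun v => s v x) k = take k.+1 l.
  apply: (positions_history lh (i0 := i0)) kn; first by move=> k' kn'; exact: px.
  move=> k' b kn' bE; rewrite px//.
  have hk' : (h k' < n.+1)%N by rewrite ltnS (leq_trans (hle _ kn'))// ltnW.
  have := tQ k' kn'; rewrite /label_constraint /= => /eqP e; rewrite sx// -[RHS]e.
  congr (t _ _); apply: val_inj; rewrite /= bE px// val_insubd.
  have -> : outdegree (fun k => par k x) k' (h k') = outdegree h k' (h k').
    rewrite /outdegree; apply: eq_in_count => j; rewrite mem_iota add0n /= => jk.
    by rewrite px// (ltn_trans jk).
  by rewrite (outdegree_ltm iinj).
rewrite /X /labelled_tree /history_tree posE//.
Qed.

End preferential_attachment_history.

(** * Split trees *)

Section prefix_counts.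
Variables (k : nat).
Local Notation m := k.+1.
Implicit Types (u v w : seq 'I_m) (L U : seq (seq 'I_m)).

Lemma prefix_rcons_eq u w (b : 'I_m) : prefix u (rcons w b) = prefix u w || (u == rcons w b).
Proof.
apply/idP/orP => [/prefixP[s]|[/prefixP[s ->]|/eqP ->]]; last 2 first.
- by rewrite rcons_cat prefix_prefix.
- exact: prefix_refl.
case/lastP: s => [|s c]; first by rewrite cats0 => ->; right.
by rewrite -rcons_cat => /rcons_inj[-> _]; left; exact: prefix_prefix.
Qed.

Lemma sum_prefix_rcons u w :
  (\sum_(i < m) prefix (rcons u i) w = (prefix u w && (u != w)) :> nat)%N.
Proof.
elim/last_ind: w => [|w b IH].
  rewrite big1; last by case: u => [|? ?] i _.
  by case: u.
under eq_bigr do rewrite prefix_rcons_eq.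
have d (i : 'I_m) : (prefix (rcons u i) w || (rcons u i == rcons w b) : nat) =
    (prefix (rcons u i) w + ((u == w) && (i == b)))%N.
  rewrite eqseq_rcons; case: (boolP (prefix _ _)) => //= /prefixP[s e].
  case: eqP => // uw; move: (congr1 size e).
  by rewrite size_cat size_rcons uw => h; exfalso; move: h; lia.
rewrite (eq_bigr _ (fun i _ => d i)) big_split /= IH.
rewrite prefix_rcons_eq.
have [->|uw] /= := eqVneq u w.
  rewrite andbF (bigD1 b)//= eqxx big1 => [|i /negbTE -> //].
  rewrite prefix_refl add0n addn0 /=; case: eqP => // /(congr1 size).
  by rewrite size_rcons => /n_Sn.
rewrite big1// addn0 andbT.
have [->|] := eqVneq u (rcons w b); last by rewrite orbF andbT.
rewrite andbF; case: (boolP (prefix _ _)) => // /prefixP[s /(congr1 size)].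
by rewrite size_cat size_rcons; lia.
Qed.

Definition subtree_size L u := count (prefix u) L.

Lemma sum_subtree_size L u : uniq L -> u \in L ->
  (\sum_(i < m) subtree_size L (rcons u i)).+1 = subtree_size L u.
Proof.
move=> uL uinL.
suff : (\sum_(i < m) subtree_size L (rcons u i) + count_mem u L = subtree_size L u)%N.
  by rewrite count_uniq_mem// uinL addn1.
rewrite /subtree_size; elim: L {uL uinL} => [|w L IH] /=; first by rewrite big1.
rewrite big_split /= addnACA IH; congr (_ + _)%N.
rewrite sum_prefix_rcons eq_sym; have [->|_] := eqVneq w u; first by rewrite prefix_refl.
by rewrite andbT addn0.
Qed.

Lemma prod_path (R : comRingType) (F : seq 'I_m -> 'I_m -> R) U w :
  uniq U -> (forall j, (j < size w)%N -> take j w \in U) ->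
  \prod_(u <- U) \prod_(i < m) F u i ^+ prefix (rcons u i) w =
  \prod_(j < size w) F (take j w) (nth ord0 w j).
Proof.
move=> uU; elim/last_ind: w => [_|w b IH wU].
  rewrite big_ord0 big1// => u _; rewrite big1// => i _.
  by case: u => [|? ?]; rewrite expr0.
have wU' j : (j < size w)%N -> take j w \in U.
  move=> jw; have e : take j (rcons w b) = take j w by rewrite -cats1 takel_cat// ltnW.
  by rewrite -e; apply: wU; rewrite size_rcons ltnS ltnW.
have win : w \in U.
  by have := wU (size w); rewrite size_rcons -cats1 take_size_cat//; apply.
rewrite size_rcons big_ord_recr /=.
have -> : \prod_(j < size w) F (take j (rcons w b)) (nth ord0 (rcons w b) j) =
    \prod_(j < size w) F (take j w) (nth ord0 w j).
  by apply: eq_bigr => j _; rewrite nth_rcons ltn_ord -cats1 takel_cat// ltnW.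
rewrite -IH// nth_rcons ltnn eqxx -cats1 take_size_cat// cats1.
have e u (i : 'I_m) : F u i ^+ prefix (rcons u i) (rcons w b) =
    F u i ^+ prefix (rcons u i) w * F u i ^+ ((u == w) && (i == b)).
  rewrite -exprD prefix_rcons_eq eqseq_rcons; congr (_ ^+ _).
  case: (boolP (prefix _ _)) => //= /prefixP[s e].
  case: eqP => // uw; move: (congr1 size e).
  by rewrite size_cat size_rcons uw => h; exfalso; move: h; lia.
under eq_bigr do under eq_bigr do rewrite e.
under eq_bigr do rewrite big_split/=.
rewrite big_split/=; congr (_ * _).
rewrite (bigD1_seq w)//= (bigD1 b)//= !eqxx expr1 big1 => [|i /negbTE ->]; last by rewrite expr0.
rewrite mulr1 big1 ?mulr1// => u /negbTE uw; rewrite big1// => i _.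
by rewrite uw expr0.
Qed.

Lemma prod_paths (R : comRingType) (F : seq 'I_m -> 'I_m -> R) U L :
  uniq U -> (forall w j, w \in L -> (j < size w)%N -> take j w \in U) ->
  \prod_(w <- L) \prod_(j < size w) F (take j w) (nth ord0 w j) =
  \prod_(u <- U) \prod_(i < m) F u i ^+ subtree_size L (rcons u i).
Proof.
move=> uU; elim: L => [_|w L IH H].
  by rewrite big_nil big1// => u _; rewrite big1.
rewrite big_cons IH; last by move=> w' j h; apply: H; rewrite inE h orbT.
rewrite -(prod_path F uU); last by move=> j; apply: H; rewrite inE eqxx.
rewrite -big_split; apply: eq_bigr => u _ /=; rewrite -big_split.
by apply: eq_bigr => i _ /=; rewrite -exprD.
Qed.

Lemma rooted_prefix L w j : rooted_tree L -> w \in L -> take j w \in L.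
Proof.
move=> [_ _ pL]; elim/last_ind: w => [//|w b IH] wL.
have [jw|jw] := leqP j (size w).
  by rewrite -cats1 takel_cat// IH// (pL _ b).
by rewrite take_oversize// size_rcons.
Qed.

End prefix_counts.

Section history_weight.
Context {R : realType} (k : nat).
Local Notation m := k.+1.
Variable a : R.
Hypothesis a0 : 0 < a.
Hypothesis am : m%:R * a = 1 + a.
Implicit Types (u v w : seq 'I_m) (L U : seq (seq 'I_m)).

(* The moment E \prod_i P_i^(N_i) of a split vector P with parameters a, N_i being
   the number of nodes of L in the subtree of the i-th child of u. *)
Definition node_moment L u : R :=
  \prod_(i < m) rising a (subtree_size L (rcons u i)) /
     rising (\sum_(i < m) a) (\sum_(i < m) subtree_size L (rcons u i)).

Lemma risingD_bool (p : R) n (b : bool) : rising p (n + b) = rising p n * (p + n%:R) ^+ b.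
Proof. by case: b; rewrite ?addn0 ?addn1 ?expr0 ?mulr1// /rising big_ord_recr. Qed.

Lemma subtree_size_rcons L v u : subtree_size (rcons L v) u = (subtree_size L u + prefix u v)%N.
Proof. by rewrite /subtree_size -cats1 count_cat /= addn0. Qed.

Lemma node_moment_rcons L v u : uniq L -> u \in L ->
  node_moment (rcons L v) u = node_moment L u *
   \prod_(i < m) ((a + (subtree_size L (rcons u i))%:R) / (a + (subtree_size L u)%:R))
      ^+ prefix (rcons u i) v.
Proof.
move=> uL uinL; rewrite /node_moment.
under eq_bigr do rewrite subtree_size_rcons risingD_bool.
under [X in rising _ X]eq_bigr do rewrite subtree_size_rcons.
rewrite !big_split /= sum_prefix_rcons risingD_bool.
set S := (\sum_(i < m) subtree_size L (rcons u i))%N.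
have e : \sum_(i < m) a + S%:R = a + (subtree_size L u)%:R.
  rewrite -(sum_subtree_size uL uinL) -/S sumr_const card_ord -[a *+ _]mulr_natl am -natr1.
  by ring.
rewrite e; under [X in _ = _ * X]eq_bigr do rewrite expr_div_n.
rewrite [X in _ = _ * X]big_split /=  prodfV prodrXr sum_prefix_rcons.
by rewrite invfM mulrACA.
Qed.

Lemma node_moment_new L v : rooted_tree L -> v \notin L -> node_moment (rcons L v) v = 1.
Proof.
move=> rL vL.
have h (i : 'I_m) : subtree_size (rcons L v) (rcons v i) = 0%N.
  rewrite subtree_size_rcons.
  have -> : prefix (rcons v i) v = false.
    by apply/negP => /size_prefix; rewrite size_rcons ltnn.
  rewrite addn0; apply/eqP; rewrite -leqn0 leqNgt -has_count; apply/hasPn => w wL.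
  apply/negP => /prefixP[s ws]; move/negP : vL; apply.
  have := rooted_prefix (size v) rL wL.
  by rewrite ws -cats1 -catA take_size_cat.
rewrite /node_moment [X in _ / rising _ X]big1//.
by rewrite big1 => [|i _]; rewrite ?h /rising !big_ord0 ?divr1.
Qed.

Lemma subtree_size0 L v : rooted_tree L -> v \notin L -> subtree_size L v = 0%N.
Proof.
move=> rL vL; apply/eqP; rewrite -leqn0 leqNgt -has_count; apply/hasPn => w wL.
apply/negP => /prefixP[s ws]; move/negP : vL; apply.
by have := rooted_prefix (size v) rL wL; rewrite ws take_size_cat.
Qed.

Lemma history_moment n l : l \in histories m n ->
  \prod_(u <- l) node_moment l u = (size (histories m n))%:R^-1.
Proof.
elim: n l => [|n IH] l.
  rewrite inE => /eqP ->; rewrite big_seq1.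
  have h (i : 'I_m) : subtree_size [:: [::]] (rcons [::] i) = 0%N by [].
  rewrite /node_moment [X in _ / rising _ X]big1//.
  by rewrite big1 => [|i _]; rewrite ?h /rising !big_ord0 ?divr1 ?invr1.
move=> /historiesSP[l' l'h [v /externalP[w [b [ve wl' vl']]] ->]].
have rl' := histories_rooted l'h; have [ul' nl' _] := rl'.
rewrite size_histories// big_ord_recr -size_histories// natrM invfM.
rewrite -cats1 big_cat big_seq1 cats1 /= node_moment_new// mulr1.
rewrite big_seq (eq_bigr _ (fun u ul => node_moment_rcons v ul' ul)) -big_seq big_split /= IH//.
rewrite (prod_path (fun u i => (a + (subtree_size l' (rcons u i))%:R) /
  (a + (subtree_size l' u)%:R)))//; last first.
  move=> j; rewrite ve size_rcons ltnS => jw.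
  by rewrite -cats1 takel_cat//; exact: rooted_prefix.
pose f j := a + (subtree_size l' (take j v))%:R.
have f0 j : f j != 0 by rewrite gt_eqF// ltr_wpDr.
have -> : \prod_(j < size v) ((a + (subtree_size l' (rcons (take j v) (nth ord0 v j)))%:R) /
      (a + (subtree_size l' (take j v))%:R)) = f (size v) / f 0%N.
  rewrite -(big_mkord predT (fun j => (a + (subtree_size l' (rcons (take j v) (nth ord0 v j)))%:R) /
      (a + (subtree_size l' (take j v))%:R))) /=.
  rewrite (eq_big_nat _ _ (F2 := fun j => f j.+1 / f j)); last first.
    by move=> j /andP[_ jv]; rewrite /f (take_nth ord0 jv).
  elim: (size v) => [|j IHj]; first by rewrite big_geq// divff.
  by rewrite big_nat_recr//= IHj; field; rewrite !f0.
congr (_ * _).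
rewrite /f take0 take_size subtree_size0// addr0.
have -> : subtree_size l' [::] = n.+1.
  rewrite -(histories_size l'h) /subtree_size; apply/eqP; rewrite -all_count.
  by apply/allP => u _; rewrite prefix0s.
have e : k%:R * a = 1 by move: am; rewrite -natr1 mulrDl mul1r => /addIr.
have k0 : k%:R != 0 :> R by apply: contra_eq_neq e => ->; rewrite mul0r eq_sym oner_eq0.
have -> : a = k%:R^-1 by rewrite -[LHS](mulKf k0) e mulr1.
have K0 : 0 < k%:R :> R by rewrite lt_neqAle eq_sym k0 ler0n.
rewrite -[in RHS]natr1 natrM; field; rewrite k0 /=.
by rewrite gt_eqF// ltr_wpDl// mulr_ge0.
Qed.

End history_weight.

Section split_tree_history.
Variables (k n : nat) (l : seq (seq 'I_k.+1)).
Local Notation m := k.+1.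
Hypothesis lh : l \in histories m n.
Local Open Scope nat_scope.

Lemma take_history j : j <= n -> take j.+1 l \in histories m j.
Proof.
clear -lh; elim: n l lh j => [|n' IH] l' h j.
  rewrite leqn0 => /eqP ->; move: h; rewrite inE => /eqP ->.
  by rewrite inE.
rewrite leq_eqVlt => /orP[/eqP ->|jn].
  by rewrite -(histories_size h) take_size.
move: h => /historiesSP[l1 l1h [v _ ->]].
rewrite -cats1 takel_cat; last by rewrite (histories_size l1h) ltnS -ltnS.
by apply: IH.
Qed.

Lemma history_prefix j b : j <= n -> b < size (nth [::] l j) ->
  take b (nth [::] l j) \in take j l.
Proof.
case: j => [|j] jn; first by rewrite (history_nth0 lh).
have /externalP[u [i [-> ul _]]] := external_history lh jn.
rewrite size_rcons ltnS => bu; rewrite -cats1 takel_cat//.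
by apply: rooted_prefix ul; apply: histories_rooted (take_history (ltnW jn)).
Qed.

Lemma history_notin j : j <= n -> nth [::] l j \notin take j l.
Proof.
case: j => [|j] jn; first by rewrite take0.
by have /externalP[u [i [_ _ ->]]] := external_history lh jn.
Qed.

Lemma size_history_node j : j <= n -> size (nth [::] l j) <= j.
Proof.
elim/ltn_ind: j => -[|j] IH jn; first by rewrite (history_nth0 lh).
have [hj ->] := history_parentP ord0 lh jn.
rewrite size_rcons ltnS.
exact: leq_trans (IH _ hj (leq_trans hj (ltnW jn))) hj.
Qed.

Lemma ball_position_path (c : seq 'I_m -> 'I_m) (T : tree m) (w : seq 'I_m) f b :
  (forall j, j < size w -> take j w \in T /\ c (take j w) = nth ord0 w j) -> w \notin T ->
  b <= size w -> size w - b <= f -> ball_position c T f (take b w) = w.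
Proof.
move=> hw wT; elim: f b => [|f IH] b bw /=.
  by rewrite leqn0 subn_eq0 => wb; rewrite take_oversize.
move=> wbf; have [bw'|wb] := ltnP b (size w).
  have [-> ->] := hw b bw'; rewrite -(take_nth ord0 bw').
  by apply: IH => //; lia.
by rewrite (take_oversize wb) (negbTE wT).
Qed.

Lemma split_tree_history (C : nat -> seq 'I_m -> 'I_m) :
  (forall j b, j <= n -> b < size (nth [::] l j) ->
    C j (take b (nth [::] l j)) = nth ord0 (nth [::] l j) b) ->
  forall j, j <= n.+1 -> split_tree C j = [fset v in take j l]%fset.
Proof.
move=> hC; elim=> [_|j IH jn].
  by apply/fsetP => v; rewrite take0 !inE.
rewrite /= (IH (ltnW jn)).
have -> : ball_position (C j) [fset v in take j l]%fset j [::] = nth [::] l j.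
  rewrite -[X in ball_position _ _ _ X](take0 (nth [::] l j)).
  apply: ball_position_path => //.
  - move=> b bw; split; last exact: hC.
    by rewrite inE; exact: history_prefix.
  - by rewrite inE history_notin.
  - by rewrite subn0 size_history_node.
apply/fsetP => v; rewrite !inE (take_nth [::]) ?(histories_size lh)//.
by rewrite mem_rcons inE.
Qed.

End split_tree_history.

Section split_probabilities.
Context {R : realType} (k : nat) d (O : measurableType d) (P : probability O R).
Local Notation m := k.+1.
Variables (V : node m -> {RV P >-> m.-tuple R}) (C : nat -> node m -> O -> 'I_m).
Hypothesis k0 : (0 < k)%N.
Let a : R := (m%:R - 1)^-1.
Hypothesis hVC : split_model (dirichlet (fun _ : 'I_m => a)) V C.

Let Y (x : O) n := split_tree (fun j v => C j v x) n.+1.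

Lemma split_param_gt0 : 0 < a.
Proof. by rewrite /a -natr1 addrK invr_gt0 ltr0n. Qed.

Lemma split_param_eq : m%:R * a = 1 + a.
Proof.
have : k%:R != 0 :> R by rewrite pnatr_eq0 -lt0n.
by rewrite /a -natr1 addrK => h; field.
Qed.

Lemma ae_simplex (U : seq (seq 'I_m)) :
  {ae P, forall x, forall u, u \in U -> @simplex R m (V u x)}.
Proof.
case: hVC => hV _ _ _; elim: U => [|u U IH].
  by apply: aeW => x u; rewrite in_nil.
have h := dirichlet_ae_simplex (al := fun _ => a) (hV u).
apply: filterS2 h IH => x h1 h2 v; rewrite inE => /orP[/eqP ->//|]; exact: h2.
Qed.

Lemma choices_expectation n l : l \in histories m n ->
  (\int[P]_x (\prod_(w <- l) \prod_(j < size w) tnth (V (take j w) x) (nth ord0 w j))%:E =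
   ((size (histories m n))%:R^-1)%:E)%E.
Proof.
move=> lh; have rl := histories_rooted lh; have [ul _ _] := rl.
have [hV Vind _ _] := hVC.
pose f (u : node m) (t : m.-tuple R) := \prod_(i < m) `|tnth t i| ^+ subtree_size l (rcons u i).
have mf u : measurable_fun setT (f u).
  apply: measurable_prod => i _; apply: measurable_funX.
  exact: measurableT_comp (@normr_measurable _ _) (measurable_tnth i).
have f0 u t : 0 <= f u t by apply: prodr_ge0 => i _; rewrite exprn_ge0.
have E u : (\int[P]_x (f u (V u x))%:E = (node_moment a l u)%:E)%E.
  pose N j := subtree_size l (rcons u (inord j)).
  have := dirichlet_moment (al := fun _ => a) (fun _ => split_param_gt0) (hV u) N.
  rewrite /N /node_moment /f.
  have e (i : 'I_m) : subtree_size l (rcons u (inord i)) = subtree_size l (rcons u i).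
    by rewrite inord_val.
  under eq_integral do under eq_bigr do rewrite e.
  by under [in RHS]eq_bigr do rewrite e; under [X in (_ / rising _ X)%:E]eq_bigr do rewrite e.
rewrite -(history_moment split_param_gt0 split_param_eq lh).
rewrite -(independent_expectation Vind ul mf f0 E).
have pE x : \prod_(w <- l) \prod_(j < size w) tnth (V (take j w) x) (nth ord0 w j) =
    \prod_(u <- l) \prod_(i < m) (tnth (V u x) i) ^+ subtree_size l (rcons u i).
  apply: (prod_paths (fun u i => tnth (V u x) i)) => // w j wl _.
  exact: rooted_prefix.
under eq_integral do rewrite pE.
have mV u i : measurable_fun setT (fun x => tnth (V u x) i).
  by apply: (measurableT_comp (measurable_tnth i)); exact: measurable_funPT.
apply: ae_eq_integral => //.
- apply/measurable_EFinP; apply: measurable_prod => u _; apply: measurable_prod => i _.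
  exact: measurable_funX.
- apply/measurable_EFinP; apply: measurable_prod => u _.
  by apply: measurableT_comp => //; exact: measurable_funPT.
apply: filterS (ae_simplex l) => x hx _; congr EFin.
rewrite big_seq [RHS]big_seq; apply: eq_bigr => u /hx[tu _].
by apply: eq_bigr => i _; rewrite ger0_norm.
Qed.

Lemma measurable_choices (J : {fset nat * node m}) (c : nat * node m -> 'I_m) :
  measurable [set x | forall q, q \in J -> C q.1 q.2 x = c q].
Proof.
have [_ _ mC _] := hVC.
have -> : [set x | forall q, q \in J -> C q.1 q.2 x = c q] =
    \bigcap_(q in [set` J]) (C q.1 q.2 @^-1` [set c q]).
  by apply/seteqP; split => x hx q; exact: hx.
by apply: fin_bigcap_measurable => // q _; exact: mC.
Qed.

Lemma discrete_rv_ball_position j (T : tree m) f (v : seq 'I_m) :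
  discrete_rv (fun x => ball_position (fun u => C j u x) T f v : seq 'I_m).
Proof.
have [_ _ mC _] := hVC.
elim: f v => [|f IH] v /=; first exact: discrete_rv_cst.
have [vT|vT] := boolP (v \in T); last exact: discrete_rv_cst.
exact: (discrete_rv_bind (g := fun b x => ball_position (fun u => C j u x) T f (rcons v b))
  (mC j v)).
Qed.

Lemma discrete_rv_split_tree n : discrete_rv (Y ^~ n).
Proof.
rewrite /Y; elim: n.+1 => [|j IH] /=; first exact: discrete_rv_cst.
apply: (discrete_rv_bind (g := fun T x =>
  (ball_position (fun u => C j u x) T j [::] |` T)%fset : tree m) IH) => T.
move=> B.
exact: (discrete_rv_ball_position j T j [::] [set w | B (w |` T)%fset]).
Qed.

Lemma le_history_probability_split n l : l \in histories m n ->
  (((size (histories m n))%:R^-1)%:E <= P [set x | agree_upto n (Y x) (history_tree l)])%E.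
Proof.
move=> lh.
pose pairs := [seq (j, take b (nth [::] l j)) |
  j <- iota 0 n.+1, b <- iota 0 (size (nth [::] l j))].
have upairs : uniq pairs.
  apply: allpairs_uniq_dep; first exact: iota_uniq.
    by move=> j _; exact: iota_uniq.
  move=> [j b] [j' b'] /allpairsPdep[x [y [_ yI [-> ->]]]].
  move=> /allpairsPdep[x' [y' [_ yI' [-> ->]]]] /= [e].
  move: yI yI'; rewrite -e !mem_iota !add0n /= => yI yI' /(congr1 size).
  by rewrite (size_takel (ltnW yI)) (size_takel (ltnW yI')) => ->.
have perm_fset (r : seq (nat * node m)) : uniq r -> perm_eq [fset q in r]%fset r.
  by move=> ur; apply: uniq_perm => // q; rewrite inE.
have mem_fset (r : seq (nat * node m)) q : (q \in [fset q in r]%fset) = (q \in r) by rewrite inE.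
have big_iota N (F : nat -> R) : \prod_(b <- iota 0 N) F b = \prod_(b < N) F b.
  by rewrite -(big_mkord xpredT) /index_iota subn0.
pose J := [fset q in pairs]%fset.
pose c (q : nat * node m) := nth ord0 (nth [::] l q.1) (size q.2).
have [_ _ _ hC] := hVC.
have PG : P [set x | forall q, q \in J -> C q.1 q.2 x = c q] = ((size (histories m n))%:R^-1)%:E.
  rewrite -(choices_expectation lh) -[X in P X]setTI hC; last first.
    have : <<s \bigcup_i preimage_set_system setT (V i) measurable >> (setT `\` set0).
      apply: sigma_algebraCD => //; exact: sigma_algebra0.
    by rewrite setD0.
  apply: eq_integral => x _; congr EFin.
  transitivity (\prod_(q <- pairs) tnth (V q.2 x) (c q)).
    apply: perm_big; exact: perm_fset.
  rewrite big_allpairs_dep.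
  rewrite (big_nth [::]) (histories_size lh) /index_iota subn0.
  apply: eq_bigr => j _; rewrite big_iota.
  by apply: eq_bigr => b _; rewrite /c /= size_takel// ltnW.
rewrite -PG; apply: le_measure; rewrite ?inE.
- exact: measurable_choices.
- exact: measurable_agree_upto discrete_rv_split_tree.
move=> x hx j jn; rewrite /Y /history_tree.
apply: (split_tree_history lh) => // j' b jn' bw.
have qJ : (j', take b (nth [::] l j')) \in J.
  by rewrite mem_fset; apply/allpairsPdep; exists j', b; rewrite !mem_iota !add0n ltnS.
by rewrite (hx _ qJ) /c /= size_takel// ltnW.
Qed.

End split_probabilities.

(** * Comparison of the two laws *)

Lemma history_law (R : realType) d (O : measurableType d) (P : probability O R) m
    (X : O -> nat -> tree m) (n : nat) (t : nat -> tree m) :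
  (0 < m)%N -> (forall j, discrete_rv (X ^~ j)) ->
  (forall l, l \in histories m n ->
    (((size (histories m n))%:R^-1)%:E <= P [set x | agree_upto n (X x) (history_tree l)])%E) ->
  P [set x | agree_upto n (X x) t] =
    if `[< exists2 l, l \in histories m n & agree_upto n (history_tree l) t >]
    then ((size (histories m n))%:R^-1)%:E else 0%E.
Proof.
move=> m0 mX hX.
have s0 : (0 < size (histories m n))%N by rewrite size_histories// prodn_gt0.
have mE t' : measurable [set x | agree_upto n (X x) t'] by exact: measurable_agree_upto.
have dE l l' : l \in histories m n -> l' \in histories m n ->
    [set x | agree_upto n (X x) (history_tree l)] `&`
    [set x | agree_upto n (X x) (history_tree l')] !=set0 -> l = l'.
  move=> lh lh' [x [h1 h2]]; apply: (history_tree_inj lh lh') => j jn.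
  by rewrite -h1// h2.
have [h1 h2] := uniform_atoms (uniq_histories m n) s0 (fun l => mE (history_tree l)) dE hX.
case: asboolP => [[l lh lt]|ht].
  rewrite -(h1 _ lh); congr (P _); apply/seteqP; split => x hx j jn.
    by rewrite lt// hx.
  by rewrite -lt// hx.
apply: h2 => // l lh; apply/seteqP; split => // x [h3 h4]; apply: ht.
by exists l => // j jn; rewrite -h3// h4.
Qed.

Theorem theorem6p3 (R : realType) (m : nat) (hm : (2 <= m)%N)
  (d1 : measure_display) (O1 : measurableType d1) (P1 : probability O1 R)
  (par : nat -> O1 -> nat) (s : nat -> O1 -> {perm 'I_m})
  (hpar : preferential_attachment P1 (fun k => m%:R - k%:R) par)
  (hs : uniform_labelling P1 par s)
  (d2 : measure_display) (O2 : measurableType d2) (P2 : probability O2 R)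
  (V : node m -> {RV P2 >-> m.-tuple R}) (C : nat -> node m -> O2 -> 'I_m)
  (hVC : split_model (dirichlet (fun _ : 'I_m => (m%:R - 1)^-1)) V C) :
  same_law
    P1 (fun x n => labelled_tree (fun k => par k x) (fun v => s v x) n.+1)
    P2 (fun y n => split_tree (fun k v => C k v y) n.+1).
Proof.
case: m hm s hpar hs V C hVC => [//|k] hm s hpar hs V C hVC.
have m0 : (0 < k.+1)%N by [].
have k0 : (0 < k)%N by [].
have X1 := discrete_rv_labelled_tree hpar hs.
have X2 := discrete_rv_split_tree hVC.
apply: (same_law_prefix X1 X2) => n t.
rewrite (history_law t m0 X1 (fun l => le_history_probability_labelled m0 hpar hs (l := l))).
by rewrite (history_law t m0 X2 (fun l => le_history_probability_split k0 hVC (l := l))).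
Qed.
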